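(* Let $k$ be a field, let $H$ be a weak Hopf algebra over $k$ with bijective antipode $S$, let $B$ be an $H$-bicomodule algebra with right coaction $\rho_B(b)=b_{(0)}\otimes b_{(1)}\in B\otimes H$ and left coaction $\lambda_B(b)=b_{<-1>}\otimes b_{<0>}\in H\otimes B$, and let $v:H\to B$ be a morphism of $H$-bicomodule algebras (where $H$ is an $H$-bicomodule algebra via $\Delta$ on both sides). Let $$A=B^{co(H)}=\{b\in B:\rho_B(b)=b_{(0)}\otimes\varepsilon_t(b_{(1)})\},$$ with multiplication and unit restricted from $B$, left $H$-action $h\triangleright a=E(v(h)a)$, where $E(b)=b_{(0)}v(S(b_{(1)}))$, and with the map $A\to H\otimes A$, $a\mapsto a_{<-1>}\otimes a_{<0>}$, obtained by restricting $\lambda_B$. Then $A$ is a left $H$-comodule algebra. Moreover, if the smash product $A\# H=A\otimes_{H_t}H$ is regarded as an $H$-bicomodule algebra with coactions $$\rho(a\# h)=(a\# h_1)\otimes h_2,\qquad \lambda(a\# h)=a_{<-1>}h_1\otimes(a_{<0>}\# h_2),$$ then the map $\phi:A\# H\to B$, $\phi(a\# h)=a\,v(h)$, is an isomorphism of $H$-bicomodule algebras.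
   Context: All algebras and unadorned tensor products are over the base field $k$; $\Delta(h)=h_1\otimes h_2$, $\Delta(1)=1_1\otimes1_2$. Weak Hopf algebra: a linear space $H$ that is an associative unital algebra and a coassociative counital coalgebra $(H,\Delta,\varepsilon)$, with a linear map $S:H\to H$ (antipode), such that $\Delta(hh')=\Delta(h)\Delta(h')$; $\Delta^2(1)=(\Delta(1)\otimes1)(1\otimes\Delta(1))=(1\otimes\Delta(1))(\Delta(1)\otimes1)$, where $\Delta^2=(\Delta\otimes id)\Delta$; $\varepsilon(xyz)=\varepsilon(xy_1)\varepsilon(y_2z)=\varepsilon(xy_2)\varepsilon(y_1z)$; $h_1S(h_2)=\varepsilon(1_1h)1_2$; $S(h_1)h_2=1_1\varepsilon(h1_2)$; $S(h_1)h_2S(h_3)=S(h)$. Set $\varepsilon_t(h)=\varepsilon(1_1h)1_2$, $\varepsilon_s(h)=1_1\varepsilon(h1_2)$, $H_t=\varepsilon_t(H)$, $H_s=\varepsilon_s(H)$; $H_t$ and $H_s$ are subalgebras of $H$. Left $H$-module algebra: an associative unital algebra $A$ that is a left $H$-module with $h\cdot(ab)=(h_1\cdot a)(h_2\cdot b)$ and $h\cdot1_A=\varepsilon_t(h)\cdot1_A$. Its smash product $A\# H$ is the relative tensor product $A\otimes_{H_t}H$, where $H$ is a left $H_t$-module by multiplication and $A$ is a right $H_t$-module via $a\cdot z=a(z\cdot1_A)$; $a\# h$ denotes the class of $a\otimes h$; the multiplication is $(a\# h)(a'\# h')=a(h_1\cdot a')\# h_2h'$ and the unit is $1_A\#1_H$.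 Right $H$-comodule algebra: an associative unital algebra $A$ with a linear map $\rho:A\to A\otimes H$ such that $(id\otimes\varepsilon)\rho=id$, $(\rho\otimes id)\rho=(id\otimes\Delta)\rho$, $\rho(1_A)(a\otimes1_H)=(id\otimes\varepsilon_t)(\rho(a))$, $\rho(ab)=\rho(a)\rho(b)$. Left $H$-comodule algebra: an associative unital algebra $A$ with a linear map $\lambda:A\to H\otimes A$ such that $(\varepsilon\otimes id)\lambda=id$, $(id\otimes\lambda)\lambda=(\Delta\otimes id)\lambda$, $(1_H\otimes a)\lambda(1_A)=(\varepsilon_s\otimes id)(\lambda(a))$, $\lambda(ab)=\lambda(a)\lambda(b)$. $H$-bicomodule algebra: both a left and a right $H$-comodule algebra with $(\lambda\otimes id)\rho=(id\otimes\rho)\lambda$. A morphism of $H$-bicomodule algebras is an algebra map intertwining the left and the right coactions. A left-left Yetter-Drinfeld module over $H$ is a left $H$-module and left $H$-comodule $M$ (coaction $m\mapsto m_{(-1)}\otimes m_{(0)}$) with $m_{(-1)}\otimes m_{(0)}=1_1m_{(-1)}\otimes1_2\cdot m_{(0)}$ and $(h_1\cdot m)_{(-1)}h_2\otimes(h_1\cdot m)_{(0)}=h_1m_{(-1)}\otimes h_2\cdot m_{(0)}$. Known facts that make the objects in the claim meaningful: $(A,\triangleright)$ with multiplication restricted from $B$ and unit $1_B$ is a left $H$-module algebra; $\lambda_B(A)\subseteq H\otimes A$, and $A$ with $\triangleright$ and the restricted coaction is a left-left Yetter-Drinfeld module; $\phi$ is an isomorphism of right $H$-comodule algebras. Moreover,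 whenever $A$ is a left $H$-module algebra, a left $H$-comodule algebra and a left-left Yetter-Drinfeld module (with the same action and coaction), the coactions displayed in the claim make $A\# H$ an $H$-bicomodule algebra. *)

(* Defs.v *)
From HB Require Import structures.
From mathcomp Require Import all_boot all_algebra.
From mathcomp Require Import boolp generic_quotient ring_quotient freeg.

Set Implicit Arguments.
Unset Strict Implicit.
Unset Printing Implicit Defensive.

Import GRing.Theory.
Local Open Scope ring_scope.
Local Open Scope quotient_scope.

Section Quotient.
Variables (k : fieldType) (V : lmodType k).

Inductive span (G : V -> Prop) : V -> Prop :=
| span0 : span G 0
| spanZD c g x : G g -> span G x -> span G (c *: g + x).

Definition span_pred (G : V -> Prop) : {pred V} := fun x => `[< span G x >].

Variable G : V -> Prop.

Lemma span_predP x : reflect (span G x) (x \in span_pred G).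
Proof. exact: asboolP. Qed.

Lemma span_gen x : G x -> span G x.
Proof. by move=> Gx; rewrite -[x]addr0 -[X in X + _]scale1r; apply: spanZD Gx (span0 G). Qed.

Lemma spanD x y : span G x -> span G y -> span G (x + y).
Proof.
by elim=> [|c g {}x Gg _ IH] Gy; rewrite ?add0r // -addrA; apply: spanZD (IH Gy).
Qed.

Lemma spanZ c x : span G x -> span G (c *: x).
Proof.
elim=> [|d g {}x Gg _ IH]; rewrite ?scaler0; first exact: span0.
by rewrite scalerDr scalerA; apply: spanZD.
Qed.

Fact span_submod_closed : submod_closed (span_pred G).
Proof.
split=> [|c x y /span_predP Gx /span_predP Gy]; apply/span_predP; first exact: span0.
by apply: spanD => //; apply: spanZ.
Qed.
HB.instance Definition _ := GRing.isSubmodClosed.Build k V (span_pred G)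
  (GRing.submod_closed_semi span_submod_closed).

(* The quotient of V by the subspace spanned by G. *)
Definition lquot : Type := Quotient.quot (span_pred G).
HB.instance Definition _ := GRing.Zmodule.on lquot.
HB.instance Definition _ := Quotient.on lquot.

Definition lproj (x : V) : lquot := \pi_lquot x.

Lemma lproj_surj (y : lquot) : exists x, y = lproj x.
Proof. by exists (repr y); rewrite /lproj reprK. Qed.

Lemma lproj_eq x y : lproj x = lproj y <-> span G (x - y).
Proof.
have E : (lproj x == lproj y) = (x - y \in span_pred G).
  by rewrite (Quotient.idealrBE (span_pred G)).
by split=> [/eqP|/span_predP]; [rewrite E => /span_predP|rewrite -E => /eqP].
Qed.

Fact lprojD x y : lproj (x + y) = lproj x + lproj y.
Proof. by rewrite /lproj -[in RHS]/(Quotient.quot _) !piE. Qed.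

Definition lquot_scale (c : k) (y : lquot) : lquot := lproj (c *: repr y).

Fact lprojZ c x : lquot_scale c (lproj x) = lproj (c *: x).
Proof.
by apply/lproj_eq; rewrite -scalerBr; apply/spanZ/lproj_eq; rewrite /lproj reprK.
Qed.

Fact lquot_scaleA a b y :
  lquot_scale a (lquot_scale b y) = lquot_scale (a * b) y.
Proof. by have [x ->] := lproj_surj y; rewrite !lprojZ scalerA. Qed.
Fact lquot_scale1 : left_id 1 lquot_scale.
Proof. by move=> y; have [x ->] := lproj_surj y; rewrite !lprojZ scale1r. Qed.
Fact lquot_scaleDr : right_distributive lquot_scale +%R.
Proof.
move=> a y z; have [x ->] := lproj_surj y; have [t ->] := lproj_surj z.
by rewrite -lprojD !lprojZ -lprojD scalerDr.
Qed.
Fact lquot_scaleDl y : {morph lquot_scale^~ y : a b / a + b}.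
Proof.
by move=> a b; have [x ->] := lproj_surj y; rewrite !lprojZ -lprojD scalerDl.
Qed.
HB.instance Definition _ := GRing.Zmodule_isLmodule.Build k lquot
  lquot_scaleA lquot_scale1 lquot_scaleDr lquot_scaleDl.

Fact lproj_linear : linear lproj.
Proof. by move=> c x y; rewrite lprojD -lprojZ. Qed.
HB.instance Definition _ := GRing.isLinear.Build k V lquot _ lproj lproj_linear.

Lemma lproj_gen x y : G (x - y) -> lproj x = lproj y.
Proof. by move=> Gxy; apply/lproj_eq/span_gen. Qed.
End Quotient.

Section FreeLift.
Variables (k : fieldType) (K : choiceType) (W : lmodType k).
Implicit Types (f g : K -> W) (D : {freeg K / k}).

Fact fgliftE f D : fglift f D = \sum_(x <- repr D) x.1 *: f x.2.
Proof. by rewrite /fglift -lock. Qed.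

HB.instance Definition _ f :=
  GRing.isZmodMorphism.Build {freeg K / k} W (fglift f) (lift_is_additive f).

Fact fglift_is_linear f : linear (fglift f).
Proof.
move=> c D1 D2; rewrite raddfD /=; congr (_ + _).
have -> : c *: D1 = fgscale c D1 by [].
rewrite -[D1 in RHS]freeg_sumE /fgscale !raddf_sum /=.
by apply: eq_bigr => x _; rewrite !liftU scalerA.
Qed.
HB.instance Definition _ f := GRing.isLinear.Build k {freeg K / k} W _ (fglift f)
  (fglift_is_linear f).
End FreeLift.

Section Tensor.
Variables (k : fieldType) (U V : lmodType k).

Local Notation free := {freeg (U * V)%type / k}.
Local Notation "<< u , v >>" := (Freeg [:: (1 : k, (u, v))]).

Inductive tens_rel : free -> Prop :=
| tens_rell c u1 u2 v :
    tens_rel (<< c *: u1 + u2, v >> - (c *: << u1, v >> + << u2, v >>))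
| tens_relr c u v1 v2 :
    tens_rel (<< u, c *: v1 + v2 >> - (c *: << u, v1 >> + << u, v2 >>)).

Definition tensor : Type := lquot tens_rel.
HB.instance Definition _ := GRing.Lmodule.on tensor.

Definition tens (u : U) (v : V) : tensor := lproj tens_rel << u, v >>.

Lemma tens_bilinear : bilinear_for *:%R *:%R tens.
Proof.
split=> [v c u1 u2|u c v1 v2]; rewrite /tens -linearP; apply: lproj_gen.
  exact: tens_rell.
exact: tens_relr.
Qed.
HB.instance Definition _ := bilinear_isBilinear.Build k U V tensor _ _ tens tens_bilinear.

Lemma tens_ind (P : tensor -> Prop) :
  P 0 -> (forall c u v t, P t -> P (c *: tens u v + t)) -> forall t, P t.
Proof.
move=> P0 PD t; have [D ->] := lproj_surj t.
rewrite -[D]freeg_sumE; elim: (dom D) => [|[u v] s IH]; first by rewrite big_nil linear0.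
rewrite big_cons linearD /=; set c := coeff _ _.
suff -> : lproj tens_rel << c *g (u, v) >> = c *: tens u v by apply: PD.
rewrite -linearZ /=; congr (lproj _ _).
by apply/eqP/freeg_eqP => x; rewrite coeffZ !coeffU mul1r.
Qed.

Section Lift.
Variable W : lmodType k.
Implicit Types (f g : U -> V -> W) (t : tensor).

(* [tlift f t] is the sum of the [f u_i v_i] for one chosen expression of [t] as
   a sum of pure tensors [u_i \ox v_i].  When [f] is bilinear the choice is
   immaterial and [tlift f] is the linear map induced by [f] (see [tlift_tens]
   and [tlift_linear]); [tlift] is only used for such [f], and is kept total so
   that [\sw_(x, y <- t) f x y] below can be read as Sweedler's notation. *)
Definition tlift f t : W := fglift (fun p => f p.1 p.2) (repr t).

Fact tlift_lproj f D : bilinear_for *:%R *:%R f ->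
  tlift f (lproj tens_rel D) = fglift (fun p => f p.1 p.2) D.
Proof.
case=> fl fr; rewrite /tlift; set f' := fun p => _.
apply/eqP; rewrite -subr_eq0 -linearB /=; apply/eqP.
have /lproj_eq : lproj tens_rel (repr (lproj tens_rel D)) = lproj tens_rel D.
  by rewrite /lproj reprK.
elim=> [|c g x Gg _ IH]; first by rewrite linear0.
rewrite linearP /= IH addr0.
suff -> : fglift f' g = 0 by rewrite scaler0.
case: Gg => [d u1 u2 v|d u v1 v2]; rewrite linearB linearD linearZ /= !liftU !scale1r /f' /=.
  by rewrite (fl v d u1 u2) subrr.
by rewrite (fr u d v1 v2) subrr.
Qed.

Lemma tlift_tens f u v : bilinear_for *:%R *:%R f -> tlift f (tens u v) = f u v.
Proof. by move=> fB; rewrite tlift_lproj // liftU scale1r. Qed.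

Lemma tlift_linear f : bilinear_for *:%R *:%R f -> linear (tlift f).
Proof.
move=> fB c s t; have [x ->] := lproj_surj s; have [y ->] := lproj_surj t.
by rewrite -linearP !tlift_lproj // linearP.
Qed.

Lemma eq_tlift f g t : (forall u v, f u v = g u v) -> tlift f t = tlift g t.
Proof.
by move=> fg; rewrite /tlift !fgliftE; apply: eq_bigr => p _; rewrite fg.
Qed.

Lemma tlift_param (X : lmodType k) (f : X -> U -> V -> W) t :
  (forall u v, linear (fun x => f x u v)) -> linear (fun x => tlift (f x) t).
Proof.
move=> fL c x y; rewrite /tlift !fgliftE scaler_sumr -big_split /=.
by apply: eq_bigr => p _; rewrite fL scalerDr !scalerA mulrC.
Qed.

End Lift.

Lemma comp_tlift (W X : lmodType k) (L : W -> X) (f : U -> V -> W) t :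
  linear L -> L (tlift f t) = tlift (fun u v => L (f u v)) t.
Proof.
move=> LL; pose LM := GRing.isLinear.Build k W X _ L LL.
pose L' : {linear W -> X} := HB.pack L LM.
rewrite -[L]/(L' : W -> X) /tlift !fgliftE linear_sum.
by apply: eq_bigr => p _; rewrite linearZ.
Qed.

Lemma tens_ext (W : lmodType k) (L1 L2 : tensor -> W) :
  linear L1 -> linear L2 -> (forall u v, L1 (tens u v) = L2 (tens u v)) ->
  forall t, L1 t = L2 t.
Proof.
move=> L1L L2L E; elim/tens_ind => [|c u v t IH]; last by rewrite L1L L2L IH E.
have L0 (L : tensor -> W) : linear L -> L 0 = 0.
  by move=> LL; have := LL (-1) 0 0; rewrite scaler0 addr0 scaleN1r addNr.
by rewrite !L0.
Qed.

Lemma tlift_id t : tlift tens t = t.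
Proof.
move: t; apply: tens_ext => [||u v] //; first exact/tlift_linear/tens_bilinear.
by rewrite tlift_tens //; exact: tens_bilinear.
Qed.

End Tensor.

Lemma tlift_swap (k : fieldType) (U V U' V' W : lmodType k)
    (F : U -> V -> U' -> V' -> W) (t : tensor U V) (s : tensor U' V') :
  tlift (fun u v => tlift (F u v) s) t
  = tlift (fun u' v' => tlift (fun u v => F u v u' v') t) s.
Proof.
rewrite /tlift !fgliftE.
under eq_bigr => p _ do rewrite fgliftE scaler_sumr.
rewrite exchange_big /=; apply: eq_bigr => q _.
rewrite fgliftE scaler_sumr; apply: eq_bigr => p _.
by rewrite !scalerA mulrC.
Qed.

Arguments tensor {k} (U V)%_type_scope.
Notation "U \ox V" := (tensor U V) (at level 40, left associativity) : type_scope.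
Notation "u \ox v" := (tens u v) (at level 40, left associativity) : ring_scope.
Notation "\sw_ ( x , y <- t ) F" := (tlift (fun x y => F) t)
  (at level 36, x binder, y binder, t at level 200, F at level 36,
   format "\sw_ ( x ,  y  <-  t )  F") : ring_scope.

Section LinearClosure.
Variable k : fieldType.
Implicit Types U V W X Y : lmodType k.

Lemma lin_id U : linear (fun x : U => x). Proof. by []. Qed.

Lemma lin_comp U V W (L : {linear V -> W}) (g : U -> V) :
  linear g -> linear (fun x => L (g x)).
Proof. by move=> gL c x y; rewrite gL linearP. Qed.

Lemma lin_scalel U V W (L : {scalar V}) (g : U -> V) (w : W) :
  linear g -> linear (fun x => L (g x) *: w).
Proof. by move=> gL c x y; rewrite gL linearP scalerDl scalerA. Qed.

Lemma lin_scaler U W (g : U -> W) (c : k) : linear g -> linear (fun x => c *: g x).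
Proof. by move=> gL d x y; rewrite gL scalerDr !scalerA mulrC. Qed.

Lemma lin_bil_l U V W X (f : V -> W -> X) (g : U -> V) w :
  bilinear_for *:%R *:%R f -> linear g -> linear (fun x => f (g x) w).
Proof. by move=> [fl _] gL c x y; rewrite gL; exact: (fl w c (g x) (g y)). Qed.

Lemma lin_bil_r U V W X (f : V -> W -> X) (g : U -> W) v :
  bilinear_for *:%R *:%R f -> linear g -> linear (fun x => f v (g x)).
Proof. by move=> [_ fr] gL c x y; rewrite gL; exact: (fr v c (g x) (g y)). Qed.

Lemma lin_tensl U V W (g : U -> V) (w : W) : linear g -> linear (fun x => g x \ox w).
Proof. by apply: lin_bil_l; exact: tens_bilinear. Qed.

Lemma lin_tensr U V W (g : U -> W) (v : V) : linear g -> linear (fun x => v \ox g x).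
Proof. by apply: lin_bil_r; exact: tens_bilinear. Qed.

Lemma lin_tlift U V W X (f : V -> W -> X) (g : U -> V \ox W) :
  bilinear_for *:%R *:%R f -> linear g -> linear (fun x => tlift f (g x)).
Proof. by move=> fB gL c x y; rewrite gL; exact: tlift_linear. Qed.

Lemma lin0 U V (f : U -> V) : linear f -> f 0 = 0.
Proof. by move=> fL; have := fL (-1) 0 0; rewrite scaler0 addr0 scaleN1r addNr. Qed.

Lemma linZ U V (f : U -> V) c x : linear f -> f (c *: x) = c *: f x.
Proof. by move=> fL; have := fL c x 0; rewrite !addr0 (lin0 fL) addr0. Qed.

Lemma linB U V (f : U -> V) x y : linear f -> f (x - y) = f x - f y.
Proof. by move=> fL; rewrite addrC -scaleN1r fL scaleN1r addrC. Qed.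

Lemma bilinI U V W (f : U -> V -> W) :
  (forall v, linear (fun u => f u v)) -> (forall u, linear (fun v => f u v)) ->
  bilinear_for *:%R *:%R f.
Proof. by []. Qed.

End LinearClosure.

(* [GRing.Algebra] requires 1 != 0; here the zero algebra is allowed, so that
   the existence of tensor and smash products needs no nontriviality side
   condition. *)
HB.mixin Record Lmodule_isUnitalAlgebra (k : fieldType) A of GRing.Lmodule k A := {
  aone : A;
  amul : A -> A -> A;
  amulA : associative amul;
  amul1x : left_id aone amul;
  amulx1 : right_id aone amul;
  amul_bilinear : bilinear_for *:%R *:%R amul
}.
#[short(type="unitalAlgType")]
HB.structure Definition UnitalAlgebra (k : fieldType) :=
  {A of GRing.Lmodule k A & Lmodule_isUnitalAlgebra k A}.

Notation "\1" := aone : ring_scope.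
Notation "x ** y" := (amul x y) (at level 40, left associativity) : ring_scope.

Section OfAlgType.
Variables (k : fieldType) (A : algType k).
Definition unital_of_alg : Type := A.
HB.instance Definition _ := GRing.Lmodule.on unital_of_alg.
Fact mulr_bilinear : bilinear_for *:%R *:%R ( *%R : A -> A -> A).
Proof.
split=> [b c x y|a c x y]; first by rewrite /= mulrDl scalerAl.
by rewrite /= mulrDr scalerAr.
Qed.
HB.instance Definition _ := Lmodule_isUnitalAlgebra.Build k unital_of_alg
  (@mulrA A) (@mul1r A) (@mulr1 A) mulr_bilinear.
End OfAlgType.

Section AlgLin.
Variable k : fieldType.
Variables (U : lmodType k) (A : unitalAlgType k).
Lemma lin_mull (g : U -> A) (a : A) : linear g -> linear (fun x => g x ** a).
Proof. by apply: lin_bil_l; exact: amul_bilinear. Qed.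
Lemma lin_mulr (g : U -> A) (a : A) : linear g -> linear (fun x => a ** g x).
Proof. by apply: lin_bil_r; exact: amul_bilinear. Qed.
End AlgLin.

Ltac lin_base := fail.
Ltac lin_step := first
  [ lin_base | match goal with Hlin : _ |- _ => exact: Hlin end
  | match goal with Hlin : bilinear_for _ _ _ |- _ => 
      first [apply: (lin_bil_l _ Hlin) | apply: (lin_bil_r _ Hlin)] end
  | exact: lin_id | apply: amul_bilinear | apply: tens_bilinear
  | apply: lin_mull | apply: lin_mulr
  | apply: lin_tensl | apply: lin_tensr | apply: lin_tlift
  | apply: tlift_param; intros ? ?
  | apply: lin_comp
  | apply: lin_scalel | apply: lin_scaler
  | apply: bilinI; intros ? ].
Ltac lin := solve [repeat (intros; lin_step)].

(* The algebra structure (a \ox b)(a' \ox b') = aa' \ox bb' on [A \ox B]. *)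
Section TensorAlgebra.
Variables (k : fieldType) (A B : unitalAlgType k).
Definition tmul (s t : A \ox B) : A \ox B :=
  \sw_(a, b <- s) \sw_(a', b' <- t) ((a ** a') \ox (b ** b')).

Fact tmul_bilinear : bilinear_for *:%R *:%R tmul.
Proof. rewrite /tmul. lin. Qed.
Lemma tmul_tens a b a' b' : tmul (a \ox b) (a' \ox b') = (a ** a') \ox (b ** b').
Proof. by rewrite /tmul tlift_tens ?tlift_tens //; lin. Qed.
Local Lemma lin_tmull (U : lmodType k) (g : U -> A \ox B) t :
  linear g -> linear (fun x => tmul (g x) t).
Proof. by apply: (lin_bil_l (f := tmul)); exact: tmul_bilinear. Qed.
Local Lemma lin_tmulr (U : lmodType k) (g : U -> A \ox B) t :
  linear g -> linear (fun x => tmul t (g x)).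
Proof. by apply: (lin_bil_r (f := tmul)); exact: tmul_bilinear. Qed.
Fact tmulA : associative tmul.
Proof.
move=> s t r; move: s; apply: tens_ext => [||a b]; last move: t; first 2 last.
  apply: tens_ext => [||a' b']; last move: r; first 2 last.
    apply: tens_ext => [||a'' b'']; last by rewrite !tmul_tens !amulA.
all: repeat first [apply: lin_tmull | apply: lin_tmulr | lin].
Qed.
Fact tmul1x : left_id (\1 \ox \1) tmul.
Proof.
apply: tens_ext => [||a b] //; last by rewrite tmul_tens !amul1x.
exact: lin_tmulr.
Qed.
Fact tmulx1 : right_id (\1 \ox \1) tmul.
Proof.
apply: tens_ext => [||a b] //; last by rewrite tmul_tens !amulx1.
exact: lin_tmull.
Qed.
HB.instance Definition _ := Lmodule_isUnitalAlgebra.Build k (tensor A B)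
  tmulA tmul1x tmulx1 tmul_bilinear.
Lemma tens_mul (a : A) (b : B) a' b' : (a \ox b) ** (a' \ox b') = (a ** a') \ox (b ** b').
Proof. exact: tmul_tens. Qed.
End TensorAlgebra.

Section TensorMaps.
Variable k : fieldType.

Definition tmap (U V U' V' : lmodType k) (f : U -> U') (g : V -> V') (t : U \ox V) :
  U' \ox V' := \sw_(u, v <- t) (f u \ox g v).

Definition tassoc (U V W : lmodType k) (t : (U \ox V) \ox W) : U \ox (V \ox W) :=
  \sw_(s, w <- t) \sw_(u, v <- s) (u \ox (v \ox w)).

Lemma tlift_tmap (U V U' V' W : lmodType k) (F : U' -> V' -> W) (f : U -> U') (g : V -> V') t :
  bilinear_for *:%R *:%R F -> tlift F (tmap f g t) = \sw_(u, v <- t) F (f u) (g v).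
Proof.
move=> FB; rewrite /tmap comp_tlift; last exact: tlift_linear.
by apply: eq_tlift => u v; rewrite tlift_tens.
Qed.

Lemma tlift_tassoc (U V W X : lmodType k) (F : U -> V \ox W -> X) t :
  bilinear_for *:%R *:%R F ->
  tlift F (tassoc t) = \sw_(s, w <- t) \sw_(u, v <- s) F u (v \ox w).
Proof.
move=> FB; rewrite /tassoc comp_tlift; last exact: tlift_linear.
apply: eq_tlift => s w; rewrite comp_tlift; last exact: tlift_linear.
by apply: eq_tlift => u v; rewrite tlift_tens.
Qed.

Lemma lin_tmap (U V U' V' X : lmodType k) (f : {linear U -> U'})
    (g : {linear V -> V'}) (t : X -> U \ox V) : linear t -> linear (fun x => tmap f g (t x)).
Proof. move=> tL; rewrite /tmap; lin. Qed.

Lemma lin_tassoc (U V W X : lmodType k) (t : X -> (U \ox V) \ox W) :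
  linear t -> linear (fun x => tassoc (t x)).
Proof. move=> tL; rewrite /tassoc; lin. Qed.
End TensorMaps.

Ltac lin_base ::= first [apply: lin_tmap | apply: lin_tassoc].

(* Iterated tensor products are bracketed to the right, via [tassoc]. *)
HB.mixin Record UnitalAlgebra_isWeakHopf (k : fieldType) H of UnitalAlgebra k H := {
  comul : {linear H -> (H \ox H)%type};
  counit : {scalar H};
  antipode : {linear H -> H};
  comulA : forall h,
    tassoc (tmap comul idfun (comul h)) = tmap idfun comul (comul h);
  counitl : forall h, \sw_(h1, h2 <- comul h) (counit h1 *: h2) = h;
  counitr : forall h, \sw_(h1, h2 <- comul h) (counit h2 *: h1) = h;
  comulM : forall h h', comul (h ** h') = comul h ** comul h';
  comul1l : tassoc (tmap comul idfun (comul \1)) =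
    tassoc (comul \1 \ox \1) ** (\1 \ox comul \1);
  comul1r : tassoc (tmap comul idfun (comul \1)) =
    (\1 \ox comul \1) ** tassoc (comul \1 \ox \1);
  counitM12 : forall x y z, counit (x ** y ** z) =
    \sw_(y1, y2 <- comul y) (counit (x ** y1) * counit (y2 ** z) : k^o);
  counitM21 : forall x y z, counit (x ** y ** z) =
    \sw_(y1, y2 <- comul y) (counit (x ** y2) * counit (y1 ** z) : k^o);
  antipoder : forall h, \sw_(h1, h2 <- comul h) (h1 ** antipode h2) =
    \sw_(e1, e2 <- comul \1) (counit (e1 ** h) *: e2);
  antipodel : forall h, \sw_(h1, h2 <- comul h) (antipode h1 ** h2) =
    \sw_(e1, e2 <- comul \1) (counit (h ** e2) *: e1);
  antipode3 : forall h, \sw_(h1, h23 <- comul h) \sw_(h2, h3 <- comul h23)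
    (antipode h1 ** h2 ** antipode h3) = antipode h
}.
#[short(type="weakHopfAlgType")]
HB.structure Definition WeakHopf (k : fieldType) :=
  {H of UnitalAlgebra k H & UnitalAlgebra_isWeakHopf k H}.

Section WeakHopfTheory.
Variables (k : fieldType) (H : weakHopfAlgType k).
Implicit Types g h x y z : H.

Definition eps_t h : H := \sw_(e1, e2 <- comul \1) (counit (e1 ** h) *: e2).
Definition eps_s h : H := \sw_(e1, e2 <- comul \1) (counit (h ** e2) *: e1).
Definition target z : Prop := exists h, z = eps_t h.

Fact eps_t_linear : linear eps_t.
Proof. rewrite /eps_t; lin. Qed.
HB.instance Definition _ := GRing.isLinear.Build k H H _ eps_t eps_t_linear.
Fact eps_s_linear : linear eps_s.
Proof. rewrite /eps_s; lin. Qed.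
HB.instance Definition _ := GRing.isLinear.Build k H H _ eps_s eps_s_linear.

Lemma tlift_mul (A B : unitalAlgType k) (W : lmodType k) (f : A -> B -> W) (s t : A \ox B) :
  bilinear_for *:%R *:%R f ->
  tlift f (s ** t) = \sw_(a, b <- s) \sw_(a', b' <- t) f (a ** a') (b ** b').
Proof.
move=> fB; rewrite [s ** t]/(tmul s t) /tmul comp_tlift; last exact: tlift_linear.
apply: eq_tlift => a b; rewrite comp_tlift; last exact: tlift_linear.
by apply: eq_tlift => a' b'; rewrite tlift_tens.
Qed.

Lemma sw_comulM (W : lmodType k) (f : H -> H -> W) g h :
  bilinear_for *:%R *:%R f ->
  tlift f (comul (g ** h)) =
  \sw_(g1, g2 <- comul g) \sw_(h1, h2 <- comul h) f (g1 ** h1) (g2 ** h2).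
Proof. by move=> fB; rewrite comulM tlift_mul. Qed.

Lemma sw_comulA (W : lmodType k) (f : H -> H -> H -> W) h :
  (forall y z, linear (fun x => f x y z)) -> (forall x, bilinear_for *:%R *:%R (f x)) ->
  \sw_(h1, h2 <- comul h) \sw_(h11, h12 <- comul h1) f h11 h12 h2 =
  \sw_(h1, h2 <- comul h) \sw_(h21, h22 <- comul h2) f h1 h21 h22.
Proof.
move=> f1 f23.
have f2 x z : linear (fun y => f x y z) by case: (f23 x).
have f3 x y : linear (fun z => f x y z) by case: (f23 x).
have FB : bilinear_for *:%R *:%R (fun x yz => tlift (f x) yz) by lin.
have := congr1 (tlift (fun x yz => tlift (f x) yz)) (comulA h).
rewrite tlift_tassoc // tlift_tmap; last by lin.
rewrite tlift_tmap // => E; rewrite -[RHS]E.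
apply: eq_tlift => x y; apply: eq_tlift => u v.
by rewrite tlift_tens.
Qed.

Lemma tlift_mulA (W : lmodType k) (F : H -> H \ox H -> W) (s r : H \ox H) :
  bilinear_for *:%R *:%R F ->
  tlift F (tassoc (s \ox \1) ** (\1 \ox r)) =
    \sw_(a, b <- s) F a ((b \ox \1) ** r).
Proof.
move=> FB; rewrite tlift_mul // tlift_tassoc; last by lin.
rewrite tlift_tens; last by lin.
apply: eq_tlift => a b; rewrite tlift_tens; last by lin.
by rewrite amulx1.
Qed.

Lemma tlift_mulA' (W : lmodType k) (F : H -> H \ox H -> W) (s r : H \ox H) :
  bilinear_for *:%R *:%R F ->
  tlift F ((\1 \ox r) ** tassoc (s \ox \1)) =
    \sw_(a, b <- s) F a (r ** (b \ox \1)).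
Proof.
move=> FB; rewrite tlift_mul // tlift_tens; last by lin.
rewrite tlift_tassoc; last by lin.
rewrite tlift_tens; last by lin.
by apply: eq_tlift => a b; rewrite amul1x.
Qed.

Fact comul_eps_aux g : comul (eps_t g) =
  \sw_(e1, e23 <- tmap idfun comul (comul \1)) (counit (e1 ** g) *: e23).
Proof.
rewrite tlift_tmap; last by lin.
rewrite /eps_t (comp_tlift (L := comul)); last exact: linearP.
by apply: eq_tlift => x y; rewrite linearZ.
Qed.

Lemma comul_eps_tl g : comul (eps_t g) = (eps_t g \ox \1) ** comul \1.
Proof.
have L : linear (fun x : H => (x \ox \1) ** comul \1) by lin.
rewrite comul_eps_aux -comulA comul1l tlift_mulA; last by lin.
by rewrite /eps_t (comp_tlift _ _ L); apply: eq_tlift => a b; rewrite (linZ _ _ L).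
Qed.

Lemma comul_eps_tr g : comul (eps_t g) = comul \1 ** (eps_t g \ox \1).
Proof.
have L : linear (fun x : H => comul \1 ** (x \ox \1)) by lin.
rewrite comul_eps_aux -comulA comul1r tlift_mulA'; last by lin.
by rewrite /eps_t (comp_tlift _ _ L); apply: eq_tlift => a b; rewrite (linZ _ _ L).
Qed.

Lemma comul1_eps_t : tmap idfun eps_t (comul \1) = comul \1.
Proof.
pose p (t : H \ox H) : H := \sw_(x, y <- t) (counit x *: y).
have pL : linear p by rewrite /p; lin.
have FB : bilinear_for *:%R *:%R (fun x t => x \ox p t) by lin.
have := congr1 (tlift (fun x t => x \ox p t)) comul1r.
rewrite comulA tlift_tmap // tlift_mulA' //.
under eq_tlift => x y do rewrite /p counitl.
rewrite tlift_id => E; rewrite [RHS]E /tmap; apply: eq_tlift => x y; congr (_ \ox _).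
rewrite /p tlift_mul; last by lin.
apply: eq_tlift => a b; rewrite tlift_tens; last by lin.
by rewrite amulx1.
Qed.

Lemma eps_t_comul h : \sw_(h1, h2 <- comul h) (eps_t h1 ** h2) = h.
Proof.
rewrite -[RHS]counitl -[in RHS](amul1x h) sw_comulM; last by lin.
rewrite tlift_swap; apply: eq_tlift => x y.
have L : linear (fun z => z ** y) by lin.
rewrite /eps_t (comp_tlift _ _ L); apply: eq_tlift => a b.
by rewrite (linZ _ _ L).
Qed.

Lemma sw_comul_tl (W : lmodType k) (f : H -> H -> W) z h :
  target z -> bilinear_for *:%R *:%R f ->
  tlift f (comul (z ** h)) = \sw_(h1, h2 <- comul h) f (z ** h1) h2.
Proof.
move=> [g ->] fB; rewrite comulM comul_eps_tl -amulA -comulM amul1x.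
rewrite tlift_mul // tlift_tens; last by lin.
by apply: eq_tlift => a b; rewrite amul1x.
Qed.

Lemma sw_comul_tr (W : lmodType k) (f : H -> H -> W) z h :
  target z -> bilinear_for *:%R *:%R f ->
  tlift f (comul (h ** z)) = \sw_(h1, h2 <- comul h) f (h1 ** z) h2.
Proof.
move=> [g ->] fB; rewrite comulM comul_eps_tr amulA -comulM amulx1.
rewrite tlift_mul //; apply: eq_tlift => a b; rewrite tlift_tens; last by lin.
by rewrite amulx1.
Qed.

Lemma target_eps h : target (eps_t h). Proof. by exists h. Qed.
End WeakHopfTheory.

Record module_algebra (k : fieldType) (H : weakHopfAlgType k) (A : unitalAlgType k)
    (act : H -> A -> A) : Prop := {
  act_bilinear : bilinear_for *:%R *:%R act;
  act1 : forall a, act \1 a = a;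
  actM : forall g h a, act (g ** h) a = act g (act h a);
  act_mul : forall h a b,
    act h (a ** b) = \sw_(h1, h2 <- comul h) (act h1 a ** act h2 b);
  act_one : forall h, act h \1 = act (eps_t h) \1
}.

Section Smash.
Variables (k : fieldType) (H : weakHopfAlgType k) (A : unitalAlgType k).

(* The relations a.z (x) h = a (x) zh, z in H_t, with a.z = a(z.1). *)
Inductive balanced (act : H -> A -> A) : A \ox H -> Prop :=
| Balanced a z h : target z ->
    balanced act ((a ** act z \1) \ox h - a \ox (z ** h)).

Variables (act : H -> A -> A) (actP : module_algebra act).

Definition smash of module_algebra act : Type := lquot (balanced act).
Local Notation S := (smash actP).
HB.instance Definition _ := GRing.Lmodule.on S.

Definition smash_tens (a : A) (h : H) : S := lproj (balanced act) (a \ox h).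
Local Notation "a # h" := (smash_tens a h) (at level 40).

Lemma smash_tens_bilinear : bilinear_for *:%R *:%R smash_tens.
Proof. rewrite /smash_tens; lin. Qed.

Lemma smash_balanced a z h : target z -> (a ** act z \1) # h = a # (z ** h).
Proof. by move=> tz; apply: lproj_gen; apply: Balanced. Qed.

(* The multiplication is given by Sweedler's formula on [A \ox H]; it passes to
   the quotient, see [smash_mulE] and [smash_mul_tens]. *)
Definition smash_mul0 (s t : A \ox H) : A \ox H :=
  \sw_(a, h <- s) \sw_(a', h' <- t) \sw_(h1, h2 <- comul h)
    ((a ** act h1 a') \ox (h2 ** h')).

Definition smash_mul (x y : S) : S :=
  lproj (balanced act) (smash_mul0 (repr x) (repr y)).

Let aB := act_bilinear actP.

Fact smash_mul0_bilinear : bilinear_for *:%R *:%R smash_mul0.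
Proof. rewrite /smash_mul0; lin. Qed.

Fact smash_mul0E a h a' h' : smash_mul0 (a \ox h) (a' \ox h') =
  \sw_(h1, h2 <- comul h) ((a ** act h1 a') \ox (h2 ** h')).
Proof. by rewrite /smash_mul0 tlift_tens ?tlift_tens //; lin. Qed.

Fact lproj_sw (f : H -> H -> A \ox H) t : lproj (balanced act) (tlift f t) =
  \sw_(x, y <- t) lproj (balanced act) (f x y).
Proof. by rewrite comp_tlift //; exact: lproj_linear. Qed.

Lemma act_target z a : target z -> act z a = act z \1 ** a.
Proof.
move=> tz; rewrite -[in LHS](amul1x a) (act_mul actP).
rewrite -[z in comul z]amul1x (sw_comul_tr _ tz); last by lin.
transitivity (act \1 (act z \1 ** a)); last by rewrite (act1 actP).
by rewrite (act_mul actP); apply: eq_tlift => x y; rewrite (actM actP).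
Qed.

Fact smash_mul0_l s t : balanced act s -> smash_mul0 s t = 0.
Proof.
case=> a z h tz.
have Ll r : linear (fun s => smash_mul0 s r) by exact: smash_mul0_bilinear.1.
have E r : smash_mul0 ((a ** act z \1) \ox h) r = smash_mul0 (a \ox (z ** h)) r.
  move: r; apply: tens_ext => [||a' h']; try exact: smash_mul0_bilinear.2.
  rewrite !smash_mul0E (sw_comul_tl _ tz); last by lin.
  apply: eq_tlift => h1 h2.
  by rewrite -amulA -act_target // (actM actP).
by rewrite (linB _ _ (Ll t)) E subrr.
Qed.

Fact smash_mul0_r s t : balanced act t -> lproj (balanced act) (smash_mul0 s t) = 0.
Proof.
case=> a' z h' tz; set P := lproj _.
have PL : linear P by exact: lproj_linear.
have Lr r : linear (fun t => smash_mul0 r t) by exact: smash_mul0_bilinear.2.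
have PlL r : linear (fun x => P (smash_mul0 x r)).
  by move=> c x y; rewrite (smash_mul0_bilinear.1 r c x y) PL.
rewrite (linB _ _ (Lr s)) (linB _ _ PL).
suff E : P (smash_mul0 s ((a' ** act z \1) \ox h')) = P (smash_mul0 s (a' \ox (z ** h'))).
  by rewrite E subrr.
move: s; apply: tens_ext => [||a h] //.
rewrite !smash_mul0E !(comp_tlift _ _ PL).
transitivity (\sw_(h1, h2 <- comul h) \sw_(h21, h22 <- comul h2)
    ((a ** act h1 a' ** act (h21 ** z) \1) # (h22 ** h'))).
  rewrite -(@sw_comulA _ _ _ (fun x y w => (a ** act x a' ** act (y ** z) \1) # (w ** h')));
    try by rewrite /smash_tens; lin.
  apply: eq_tlift => h1 h2; rewrite (act_mul actP).
  have L : linear (fun x => P ((a ** x) \ox (h2 ** h'))) by rewrite /P; lin.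
  rewrite (comp_tlift _ _ L); apply: eq_tlift => x y.
  by rewrite -(actM actP) amulA.
apply: eq_tlift => h1 h2.
transitivity (\sw_(h21, h22 <- comul h2)
    ((a ** act h1 a') # (eps_t (h21 ** z) ** h22 ** h'))).
  apply: eq_tlift => x y.
  by rewrite (act_one actP) smash_balanced ?amulA //; exact: target_eps.
rewrite -(@sw_comul_tr _ _ _ (fun x y => (a ** act h1 a') # (eps_t x ** y ** h'))) //;
  last by rewrite /smash_tens; lin.
have L : linear (fun x => (a ** act h1 a') # (x ** h')) by rewrite /smash_tens; lin.
by rewrite -(comp_tlift _ _ L) eps_t_comul amulA.
Qed.

Fact smash_mulE s t :
  smash_mul (lproj (balanced act) s) (lproj (balanced act) t) =
  lproj (balanced act) (smash_mul0 s t).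
Proof.
set P := lproj _.
have K (L : A \ox H -> S) x y : linear L -> (forall r, balanced act r -> L r = 0) ->
    P x = P y -> L x = L y.
  move=> LL L0 /lproj_eq G; apply/eqP; rewrite -subr_eq0 -(linB _ _ LL); apply/eqP.
  by elim: G => [|c g {}x Gg _ IH]; [exact: lin0|rewrite LL IH L0 // scaler0 add0r].
have repK x : P (repr (P x)) = P x by rewrite /P /lproj reprK.
have PL : linear P by exact: lproj_linear.
rewrite /smash_mul; transitivity (P (smash_mul0 (repr (P s)) t)).
  apply: (K (fun r => P (smash_mul0 (repr (P s)) r))) => //.
    by move=> c x y; rewrite (smash_mul0_bilinear.2 _ c x y) PL.
  by move=> r; exact: smash_mul0_r.
apply: (K (fun r => P (smash_mul0 r t))) => //.
  by move=> c x y; rewrite (smash_mul0_bilinear.1 _ c x y) PL.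
by move=> r br; rewrite smash_mul0_l // (lin0 PL).
Qed.

Fact smash_mul_tens a h a' h' : smash_mul (a # h) (a' # h') =
  \sw_(h1, h2 <- comul h) ((a ** act h1 a') # (h2 ** h')).
Proof. by rewrite smash_mulE smash_mul0E lproj_sw. Qed.

Fact smash_mul_bilinear : bilinear_for *:%R *:%R smash_mul.
Proof.
split=> [y c x1 x2|x c y1 y2].
  have [t ->] := lproj_surj y; have [s1 ->] := lproj_surj x1.
  have [s2 ->] := lproj_surj x2.
  by rewrite -linearP !smash_mulE (smash_mul0_bilinear.1 t c s1 s2) linearP.
have [t ->] := lproj_surj x; have [s1 ->] := lproj_surj y1.
have [s2 ->] := lproj_surj y2.
by rewrite -linearP !smash_mulE (smash_mul0_bilinear.2 t c s1 s2) linearP.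
Qed.

Lemma smash_ext (W : lmodType k) (L1 L2 : S -> W) : linear L1 -> linear L2 ->
  (forall a h, L1 (a # h) = L2 (a # h)) -> forall x, L1 x = L2 x.
Proof.
move=> L1L L2L E x; have [t ->] := lproj_surj x; move: t.
have PL : linear (lproj (balanced act)) by exact: lproj_linear.
by apply: tens_ext => // c x1 x2; rewrite PL ?L1L ?L2L.
Qed.

Let lin_smull (U : lmodType k) (g : U -> S) t :
  linear g -> linear (fun x => smash_mul (g x) t).
Proof. by apply: (lin_bil_l (f := smash_mul)); exact: smash_mul_bilinear. Qed.
Let lin_smulr (U : lmodType k) (g : U -> S) t :
  linear g -> linear (fun x => smash_mul t (g x)).
Proof. by apply: (lin_bil_r (f := smash_mul)); exact: smash_mul_bilinear. Qed.

Fact smash_mulA : associative smash_mul.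
Proof.
move=> s t r; move: s; apply: smash_ext => [||a h]; last move: t; first 2 last.
  apply: smash_ext => [||b g]; last move: r; first 2 last.
    apply: smash_ext => [||c f].
all: try by repeat first [apply: lin_smull | apply: lin_smulr | lin].
rewrite !smash_mul_tens.
have L1 : linear (smash_mul (a # h)) by exact: lin_smulr.
have L2 : linear (smash_mul^~ (c # f)) by exact: lin_smull.
rewrite (comp_tlift _ _ L1) (comp_tlift _ _ L2).
under eq_tlift => x y do rewrite smash_mul_tens.
under [RHS]eq_tlift => x y do rewrite smash_mul_tens.
transitivity (\sw_(g1, g2 <- comul g) \sw_(h1, h2 <- comul h) \sw_(h21, h22 <- comul h2)
   ((a ** act h1 b ** act (h21 ** g1) c) # (h22 ** g2 ** f))).
  apply: eq_tlift => g1 g2.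
  rewrite -(@sw_comulA _ _ _
    (fun x y w => (a ** act x b ** act (y ** g1) c) # (w ** g2 ** f)));
    try by rewrite /smash_tens; lin.
  apply: eq_tlift => h1 h2; rewrite (act_mul actP).
  have L : linear (fun x => (a ** x) # (h2 ** (g2 ** f))) by rewrite /smash_tens; lin.
  rewrite (comp_tlift _ _ L); apply: eq_tlift => x y.
  by rewrite (actM actP) !amulA.
rewrite tlift_swap; apply: eq_tlift => h1 h2.
rewrite sw_comulM; last by rewrite /smash_tens; lin.
by rewrite tlift_swap.
Qed.

Fact smash_mul1x : left_id (\1 # \1) smash_mul.
Proof.
apply: smash_ext => [||a h] //; first exact: lin_smulr.
rewrite smash_mul_tens -comul1_eps_t tlift_tmap; last by rewrite /smash_tens; lin.
transitivity (\sw_(e1, e2 <- comul \1) ((act e1 a ** act e2 \1) # h)).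
  apply: eq_tlift => x y; rewrite amul1x -smash_balanced; last exact: target_eps.
  by rewrite -(act_one actP).
have L : linear (fun x => x # h) by rewrite /smash_tens; lin.
by rewrite -(comp_tlift _ _ L) -(act_mul actP) (act1 actP) amulx1.
Qed.

Fact smash_mulx1 : right_id (\1 # \1) smash_mul.
Proof.
apply: smash_ext => [||a h] //; first exact: lin_smull.
rewrite smash_mul_tens.
transitivity (\sw_(h1, h2 <- comul h) (a # (eps_t h1 ** h2))).
  apply: eq_tlift => x y; rewrite amulx1 (act_one actP) smash_balanced //.
  exact: target_eps.
have L : linear (fun x => a # x) by rewrite /smash_tens; lin.
by rewrite -(comp_tlift _ _ L) eps_t_comul.
Qed.

HB.instance Definition _ := Lmodule_isUnitalAlgebra.Build k S
  smash_mulA smash_mul1x smash_mulx1 smash_mul_bilinear.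
End Smash.

Section Comodule.
Variables (k : fieldType) (H : weakHopfAlgType k).
Implicit Types B C : unitalAlgType k.

Record right_comodule_algebra B (rho : {linear B -> (B \ox H)%type}) : Prop := {
  rcoact_counit : forall b, \sw_(b0, b1 <- rho b) (counit b1 *: b0) = b;
  rcoactA : forall b,
    tassoc (tmap rho idfun (rho b)) = tmap idfun comul (rho b);
  rcoact_one : forall b, rho \1 ** (b \ox \1) = tmap idfun (@eps_t k H) (rho b);
  rcoactM : forall a b, rho (a ** b) = rho a ** rho b
}.

Record left_comodule_algebra B (lam : {linear B -> (H \ox B)%type}) : Prop := {
  lcoact_counit : forall b, \sw_(b1, b0 <- lam b) (counit b1 *: b0) = b;
  lcoactA : forall b,
    tmap idfun lam (lam b) = tassoc (tmap comul idfun (lam b));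
  lcoact_one : forall b, (\1 \ox b) ** lam \1 = tmap (@eps_s k H) idfun (lam b);
  lcoactM : forall a b, lam (a ** b) = lam a ** lam b
}.

Record bicomodule_algebra B (rho : {linear B -> (B \ox H)%type})
    (lam : {linear B -> (H \ox B)%type}) : Prop := {
  bicomod_right : right_comodule_algebra rho;
  bicomod_left : left_comodule_algebra lam;
  bicomodA : forall b,
    tassoc (tmap lam idfun (rho b)) = tmap idfun rho (lam b)
}.

Record bicomodule_algebra_morphism B C
    (rhoB : {linear B -> (B \ox H)%type}) (lamB : {linear B -> (H \ox B)%type})
    (rhoC : {linear C -> (C \ox H)%type}) (lamC : {linear C -> (H \ox C)%type})
    (f : {linear B -> C}) : Prop := {
  morph_one : f \1 = \1;
  morph_mul : forall a b, f (a ** b) = f a ** f b;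
  morph_rcoact : forall b, rhoC (f b) = tmap f idfun (rhoB b);
  morph_lcoact : forall b, lamC (f b) = tmap idfun f (lamB b)
}.

Definition bicomodule_algebra_isomorphism B C rhoB lamB rhoC lamC
    (f : {linear B -> C}) : Prop :=
  bicomodule_algebra_morphism rhoB lamB rhoC lamC f /\ bijective f.
End Comodule.

Section Coinvariants.
Variables (k : fieldType) (H : weakHopfAlgType k) (B : unitalAlgType k).
Variable rho : {linear B -> (B \ox H)%type}.

Definition coinv_pred : {pred B} :=
  fun b => rho b == tmap idfun (@eps_t k H) (rho b).

Fact coinv_submod_closed : submod_closed coinv_pred.
Proof.
have L : linear (fun b => tmap idfun (@eps_t k H) (rho b)) by rewrite /tmap; lin.
split=> [|c x y /eqP Ex /eqP Ey]; rewrite unfold_in /coinv_pred; apply/eqP.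
  by rewrite (lin0 L) linear0.
by rewrite (L c x y) -Ex -Ey linearP.
Qed.
HB.instance Definition _ := GRing.isSubmodClosed.Build k B coinv_pred
  (GRing.submod_closed_semi coinv_submod_closed).

Variable rhoP : right_comodule_algebra rho.

Lemma coinvP b : reflect (rho b = rho \1 ** (b \ox \1)) (b \in coinv_pred).
Proof. by rewrite (rcoact_one rhoP); exact: eqP. Qed.

Lemma coinv1 : \1 \in coinv_pred.
Proof. by apply/coinvP; rewrite [RHS]amulx1. Qed.

Lemma coinvM a b : a \in coinv_pred -> b \in coinv_pred -> a ** b \in coinv_pred.
Proof.
move=> /coinvP Ea /coinvP Eb; apply/coinvP.
have E1 x : rho x ** rho \1 = rho x by rewrite -(rcoactM rhoP) amulx1.
rewrite (rcoactM rhoP) Eb amulA E1 Ea -amulA; congr (_ ** _).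
by rewrite tens_mul amulx1.
Qed.

Definition coinv of right_comodule_algebra rho : Type := {b : B | b \in coinv_pred}.
Local Notation A := (coinv rhoP).
HB.instance Definition _ := SubChoice.on A.
HB.instance Definition _ := [SubChoice_isSubLmodule of A by <:].

Definition coinv_one : A := Sub \1 coinv1.
Definition coinv_mul (a b : A) : A := Sub (val a ** val b) (coinvM (valP a) (valP b)).

Fact coinv_mulA : associative coinv_mul.
Proof. by move=> a b c; apply/val_inj; rewrite /= amulA. Qed.
Fact coinv_mul1x : left_id coinv_one coinv_mul.
Proof. by move=> a; apply/val_inj; rewrite /= amul1x. Qed.
Fact coinv_mulx1 : right_id coinv_one coinv_mul.
Proof. by move=> a; apply/val_inj; rewrite /= amulx1. Qed.
Fact coinv_mul_bilinear : bilinear_for *:%R *:%R coinv_mul.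
Proof.
split=> [b c x y|a c x y]; apply/val_inj; rewrite linearP.
  exact: (amul_bilinear.1 (val b) c (val x) (val y)).
exact: (amul_bilinear.2 (val a) c (val x) (val y)).
Qed.
HB.instance Definition _ := Lmodule_isUnitalAlgebra.Build k A
  coinv_mulA coinv_mul1x coinv_mulx1 coinv_mul_bilinear.

Definition coinv_E (v : {linear H -> B}) (b : B) : B :=
  \sw_(b0, b1 <- rho b) (b0 ** v (antipode b1)).
End Coinvariants.

(* Main.v *)
From HB Require Import structures.
Require Import Defs.
From mathcomp Require Import all_boot all_algebra.

(* Write h > a for the action of h on a coinvariant a.  The counital source
   subalgebra commutes with the coinvariants, v(eps_s h) a = a v(eps_s h),
   because H_s and H_t commute; hence rho(a) = a v(1_1) (x) 1_2 and
   h > a = v(h_1) a v(S h_2).  With S antimultiplicative this gives the module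
   algebra axioms, and with S anticomultiplicative it shows that
   E(b) = b_0 v(S b_1) is a projection of B onto A, so that (id (x) E) lam_B
   takes values in H (x) A and agrees with lam_B on A.  The map phi has inverse
   b |-> E(b_0) # b_1, and the coactions of A # H are those of B transported
   along phi, so their well-definedness over H_t and the Yetter-Drinfeld condition
   need not be checked. *)

Set Implicit Arguments.
Unset Strict Implicit.
Unset Printing Implicit Defensive.

Import GRing.Theory.
Local Open Scope ring_scope.

(** * Multilinearity and Sweedler sums *)

Section MultilinearClosure.
Variable k : fieldType.
Implicit Types U V W X Y : lmodType k.

Lemma lin_compf U V W (F : V -> W) (g : U -> V) :
  linear F -> linear g -> linear (fun x => F (g x)).
Proof. by move=> FL gL c x y; rewrite gL FL. Qed.

Definition trilinear U V W X (f : U -> V -> W -> X) : Prop :=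
  [/\ forall y z, linear (fun x => f x y z), forall x z, linear (fun y => f x y z)
    & forall x y, linear (fun z => f x y z)].

Lemma lin_tri1 U V W X Y (f : V -> W -> X -> Y) (g : U -> V) w x :
  trilinear f -> linear g -> linear (fun u => f (g u) w x).
Proof. by case=> fL _ _; exact: (lin_compf (F := fun t => f t w x)). Qed.
Lemma lin_tri2 U V W X Y (f : V -> W -> X -> Y) (g : U -> W) v x :
  trilinear f -> linear g -> linear (fun u => f v (g u) x).
Proof. by case=> _ fL _; exact: (lin_compf (F := fun t => f v t x)). Qed.
Lemma lin_tri3 U V W X Y (f : V -> W -> X -> Y) (g : U -> X) v w :
  trilinear f -> linear g -> linear (fun u => f v w (g u)).
Proof. by case=> _ _ fL; exact: (lin_compf (F := fun t => f v w t)). Qed.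
End MultilinearClosure.

Lemma lin_eps_t (k : fieldType) (H : weakHopfAlgType k) (U : lmodType k) (g : U -> H) :
  linear g -> linear (fun x => eps_t (g x)).
Proof. by apply: lin_compf; exact: eps_t_linear. Qed.
Lemma lin_eps_s (k : fieldType) (H : weakHopfAlgType k) (U : lmodType k) (g : U -> H) :
  linear g -> linear (fun x => eps_s (g x)).
Proof. by apply: lin_compf; exact: eps_s_linear. Qed.

(* Each [first] tries the argument positions in which the bound variable may
   occur; multilinearity of function variables is looked up in the context. *)
Ltac mlin :=
  cbv beta delta [idfun];
  lazymatch goal with
  | |- bilinear_for _ _ _ => tryif assumption then idtac else (apply: bilinI => ?; mlin)
  | |- trilinear _ => tryif assumption then idtac else (split=> ? ?; mlin)
  | |- forall _, _ => intro; mlin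
  | |- GRing.linear_for _ (fun x => x) => apply: lin_id
  | |- GRing.linear_for _ (fun x => amul _ _) =>
    first [apply: lin_mull | apply: lin_mulr]; mlin
  | |- GRing.linear_for _ (amul _) => apply: lin_mulr; apply: lin_id
  | |- GRing.linear_for _ (fun x => tens _ _) =>
    first [apply: lin_tensl | apply: lin_tensr]; mlin
  | |- GRing.linear_for _ (tens _) => apply: lin_tensr; apply: lin_id
  | |- GRing.linear_for _ (fun x => tlift _ _) =>
    first [apply: lin_tlift | apply: tlift_param => ? ?]; mlin
  | |- GRing.linear_for _ (fun x => eps_t _) => apply: lin_eps_t; mlin
  | |- GRing.linear_for _ (fun x => eps_s _) => apply: lin_eps_s; mlin
  | |- GRing.linear_for _ (fun x => _ *: _) =>
    first [apply: lin_scalel | apply: lin_scaler]; mlin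
  | |- GRing.linear_for _ (fun x => GRing.Linear.sort _ _) => apply: lin_comp; mlin
  | Hlin : trilinear ?f |- GRing.linear_for _ (fun x => ?f _ _ _) =>
    first [apply: (lin_tri1 _ _ Hlin) | apply: (lin_tri2 _ _ Hlin)
          | apply: (lin_tri3 _ _ Hlin)]; mlin
  | Hlin : bilinear_for _ _ ?f |- GRing.linear_for _ (fun x => ?f _ _) =>
    first [apply: (lin_bil_l _ Hlin) | apply: (lin_bil_r _ Hlin)]; mlin
  | Hlin : bilinear_for _ _ ?f |- GRing.linear_for _ (?f _) =>
    apply: (lin_bil_r _ Hlin); apply: lin_id
  | Hlin : trilinear ?f |- GRing.linear_for _ (?f _ _) =>
    apply: (lin_tri3 _ _ Hlin); apply: lin_id
  | Hlin : GRing.linear_for _ ?f |- GRing.linear_for _ (fun x => ?f _) =>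
    apply: (lin_compf Hlin); mlin
  | |- _ => first [assumption | exact: linearP | exact: eps_t_linear | exact: eps_s_linear]
  end.

Section SweedlerPull.
Variables (k : fieldType) (U V : lmodType k) (A : unitalAlgType k).

Lemma mul_swr (f : U -> V -> A) t a :
  a ** (\sw_(x, y <- t) f x y) = \sw_(x, y <- t) (a ** f x y).
Proof. by apply: (comp_tlift (L := amul a)); mlin. Qed.
Lemma mul_swl (f : U -> V -> A) t a :
  (\sw_(x, y <- t) f x y) ** a = \sw_(x, y <- t) (f x y ** a).
Proof. by apply: (comp_tlift (L := amul^~ a)); mlin. Qed.
Lemma lin_sw (W X : lmodType k) (L : {linear W -> X}) (f : U -> V -> W) t :
  L (\sw_(x, y <- t) f x y) = \sw_(x, y <- t) L (f x y).
Proof. by apply: comp_tlift; exact: linearP. Qed.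
Lemma scale_sw (W : lmodType k) c (f : U -> V -> W) t :
  c *: (\sw_(x, y <- t) f x y) = \sw_(x, y <- t) (c *: f x y).
Proof. by apply: (comp_tlift (L := *:%R c)); mlin. Qed.
Lemma tens_swr (W X : lmodType k) (f : U -> V -> W) t (z : X) :
  z \ox (\sw_(x, y <- t) f x y) = \sw_(x, y <- t) (z \ox f x y).
Proof. by apply: (comp_tlift (L := fun w => z \ox w)); mlin. Qed.

Lemma sw_sw (U' V' W : lmodType k) (F : U -> V -> W) (f : U' -> V' -> U \ox V) t :
  bilinear_for *:%R *:%R F ->
  tlift F (\sw_(x, y <- t) f x y) = \sw_(x, y <- t) tlift F (f x y).
Proof. by move=> FB; apply: comp_tlift; exact: tlift_linear. Qed.

Lemma scale_mull c (a b : A) : (c *: a) ** b = c *: (a ** b).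
Proof. by apply: (linZ (f := amul^~ b)); mlin. Qed.
Lemma scale_mulr c (a b : A) : a ** (c *: b) = c *: (a ** b).
Proof. by apply: (linZ (f := amul a)); mlin. Qed.
End SweedlerPull.

(** * Weak Hopf algebras *)

Section WeakHopf.
Variables (k : fieldType) (H : weakHopfAlgType k).
Implicit Types (g h x y z : H) (W : lmodType k).

(** Sweedler legs are not terms, so coassociativity is applied inside an arbitrary trilinear context
    [f]. The [sw_] lemmas below follow this pattern, with linear, bilinear or trilinear contexts. *)
Lemma sw_coA W (f : H -> H -> H -> W) h : trilinear f ->
  \sw_(h1, h2 <- comul h) \sw_(h11, h12 <- comul h1) f h11 h12 h2 =
  \sw_(h1, h2 <- comul h) \sw_(h21, h22 <- comul h2) f h1 h21 h22.
Proof. by case=> f1 f2 f3; apply: sw_comulA => // x; split. Qed.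

Lemma counit_swl W (L : H -> W) h : linear L ->
  \sw_(h1, h2 <- comul h) (counit h1 *: L h2) = L h.
Proof.
move=> LL; rewrite -[in RHS](counitl h) (comp_tlift _ _ LL).
by apply: eq_tlift => x y; rewrite (linZ _ _ LL).
Qed.
Lemma counit_swr W (L : H -> W) h : linear L ->
  \sw_(h1, h2 <- comul h) (counit h2 *: L h1) = L h.
Proof.
move=> LL; rewrite -[in RHS](counitr h) (comp_tlift _ _ LL).
by apply: eq_tlift => x y; rewrite (linZ _ _ LL).
Qed.

(** The iterated coproduct of 1 factors through two copies of Delta(1), whose middle legs may be
    multiplied in either order: [comul1l] gives this one, [comul1r] the next lemma. Comparing them
    yields [eps_ts_comm]. *)
Lemma sw_comul1l W (f : H -> H -> H -> W) : trilinear f ->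
  \sw_(a, b <- comul \1) \sw_(x, y <- comul b) f a x y =
  \sw_(a, b <- comul \1) \sw_(c, d <- comul \1) f a (b ** c) d.
Proof.
move=> fT; have [f1 f2 f3] := fT.
have fB x : bilinear_for *:%R *:%R (f x) by split.
have FB : bilinear_for *:%R *:%R (fun x yz => tlift (f x) yz) by mlin; exact: fB.
have := congr1 (tlift (fun x yz => tlift (f x) yz)) (@comul1l k H).
rewrite comulA tlift_tmap // tlift_mulA // => ->.
apply: eq_tlift => a b; rewrite tlift_mul // tlift_tens; last by mlin.
by apply: eq_tlift => c d; rewrite amul1x.
Qed.

Lemma sw_comul1r W (f : H -> H -> H -> W) : trilinear f ->
  \sw_(a, b <- comul \1) \sw_(x, y <- comul b) f a x y =
  \sw_(a, b <- comul \1) \sw_(c, d <- comul \1) f a (c ** b) d.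
Proof.
move=> fT; have [f1 f2 f3] := fT.
have fB x : bilinear_for *:%R *:%R (f x) by split.
have FB : bilinear_for *:%R *:%R (fun x yz => tlift (f x) yz) by mlin; exact: fB.
have := congr1 (tlift (fun x yz => tlift (f x) yz)) (@comul1r k H).
rewrite comulA tlift_tmap // tlift_mulA' // => ->.
apply: eq_tlift => a b; rewrite tlift_mul //.
by apply: eq_tlift => c d; rewrite tlift_tens ?amulx1 //; mlin.
Qed.

Lemma counit_sw (U V : lmodType k) (f : U -> V -> H) t :
  counit (\sw_(u, v <- t) f u v) = \sw_(u, v <- t) (counit (f u v) : k^o).
Proof. by apply: (comp_tlift (X := k^o)); exact: linearP. Qed.

Lemma eps_tE h : eps_t h = \sw_(a, b <- comul \1) (counit (a ** h) *: b).
Proof. by []. Qed.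
Lemma eps_sE h : eps_s h = \sw_(a, b <- comul \1) (counit (h ** b) *: a).
Proof. by []. Qed.

(** The axiom [counitM21] with 1 in the middle reads eps(xh) = eps(x 1_2) eps(1_1 h), and the right
    side is eps(x eps_t(h)). *)
Lemma counit_eps_t x h : counit (x ** eps_t h) = counit (x ** h).
Proof.
rewrite -[in RHS](amulx1 x) counitM21 /eps_t mul_swr counit_sw.
by apply: (@eq_tlift _ _ _ k^o) => a b; rewrite scale_mulr linearZ /= mulrC.
Qed.
Lemma counit_eps_s x h : counit (eps_s h ** x) = counit (h ** x).
Proof.
rewrite -[in RHS](amulx1 h) counitM21 /eps_s mul_swl counit_sw.
by apply: (@eq_tlift _ _ _ k^o) => a b; rewrite scale_mull linearZ.
Qed.

Lemma eps_tMr g h : eps_t (g ** eps_t h) = eps_t (g ** h).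
Proof.
rewrite [LHS]eps_tE [RHS]eps_tE.
by apply: eq_tlift => a b; rewrite !amulA counit_eps_t.
Qed.
Lemma eps_sMl g h : eps_s (eps_s g ** h) = eps_s (g ** h).
Proof.
rewrite [LHS]eps_sE [RHS]eps_sE.
by apply: eq_tlift => a b; rewrite -!amulA counit_eps_s.
Qed.
Lemma eps_t_idem h : eps_t (eps_t h) = eps_t h.
Proof. by rewrite -[X in eps_t X]amul1x eps_tMr amul1x. Qed.

(** Pair the outer legs of Delta^2(1) with g and h under the counit. The middle leg 1_2 1'_1 then
    becomes eps_t(g) eps_s(h), and in the other order 1'_1 1_2 it becomes eps_s(h) eps_t(g). *)
Lemma eps_ts_comm g h : eps_t g ** eps_s h = eps_s h ** eps_t g.
Proof.
have fT : trilinear (fun a m d : H => counit (a ** g) *: (counit (h ** d) *: m)) by mlin.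
have E := etrans (esym (sw_comul1l fT)) (sw_comul1r fT).
transitivity (\sw_(a, b <- comul \1) \sw_(c, d <- comul \1)
  (counit (a ** g) *: (counit (h ** d) *: (b ** c)))).
  rewrite /eps_t /eps_s mul_swl; apply: eq_tlift => a b.
  rewrite mul_swr; apply: eq_tlift => c d.
  by rewrite scale_mull scale_mulr.
rewrite E /eps_t /eps_s mul_swr; apply: eq_tlift => a b.
rewrite mul_swl; apply: eq_tlift => c d.
by rewrite scale_mull scale_mulr !scalerA mulrC.
Qed.

Lemma sw_comul_eps_s W (f : H -> H -> W) g : bilinear_for *:%R *:%R f ->
  tlift f (comul (eps_s g)) =
  \sw_(a, b <- comul \1) \sw_(x, y <- comul b) (counit (g ** y) *: f a x).
Proof.
move=> fB; rewrite -(@sw_coA _ (fun a x y => counit (g ** y) *: f a x)); last by mlin.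
rewrite {1}/eps_s lin_sw sw_sw //; apply: eq_tlift => a b.
by rewrite linearZ (linZ _ _ (tlift_linear fB)) scale_sw.
Qed.

(** In eps(g 1_3) 1_1 (x) 1_2, factoring Delta^2(1) as 1_1 (x) 1'_1 1_2 (x) 1'_2 collects the primed
    copy into eps_s(g). The other order gives [sw_comul_eps_sr]. *)
Lemma sw_comul_eps_sl W (f : H -> H -> W) g : bilinear_for *:%R *:%R f ->
  tlift f (comul (eps_s g)) = \sw_(a, b <- comul \1) f a (eps_s g ** b).
Proof.
move=> fB; rewrite sw_comul_eps_s // sw_comul1r; last by mlin.
apply: eq_tlift => a b; have L : linear (fun z => f a (z ** b)) by mlin.
rewrite /eps_s (comp_tlift _ _ L); apply: eq_tlift => c d.
by rewrite (linZ _ _ L).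
Qed.
Lemma sw_comul_eps_sr W (f : H -> H -> W) g : bilinear_for *:%R *:%R f ->
  tlift f (comul (eps_s g)) = \sw_(a, b <- comul \1) f a (b ** eps_s g).
Proof.
move=> fB; rewrite sw_comul_eps_s // sw_comul1l; last by mlin.
apply: eq_tlift => a b; have L : linear (fun z => f a (b ** z)) by mlin.
rewrite /eps_s (comp_tlift _ _ L); apply: eq_tlift => c d.
by rewrite (linZ _ _ L).
Qed.

Lemma sw_comul_sl W (f : H -> H -> W) g h : bilinear_for *:%R *:%R f ->
  tlift f (comul (eps_s g ** h)) = \sw_(h1, h2 <- comul h) f h1 (eps_s g ** h2).
Proof.
move=> fB; rewrite sw_comulM // sw_comul_eps_sl; last by mlin.
rewrite -[in RHS](amul1x h) sw_comulM; last by mlin.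
by apply: eq_tlift => a b; apply: eq_tlift => c d; rewrite amulA.
Qed.

(** Expanding eps_s(1_1) introduces a second copy of Delta(1). The two copies merge into Delta^2(1),
    and the counit removes its middle leg. *)
Lemma sw_comul1_eps_s W (f : H -> H -> W) : bilinear_for *:%R *:%R f ->
  \sw_(a, b <- comul \1) f (eps_s a) b = tlift f (comul \1).
Proof.
move=> fB; transitivity (\sw_(c, d <- comul \1) \sw_(a, b <- comul \1)
    (counit (a ** d) *: f c b)).
  rewrite tlift_swap; apply: eq_tlift => a b; have L : linear (f^~ b) by mlin.
  by rewrite /eps_s (comp_tlift _ _ L); apply: eq_tlift => c d; rewrite (linZ _ _ L).
rewrite -(@sw_comul1r _ (fun c m b => counit m *: f c b)); last by mlin.
by apply: eq_tlift => c d; rewrite counit_swl //; mlin.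
Qed.
Lemma sw_comul1_eps_t W (f : H -> H -> W) : bilinear_for *:%R *:%R f ->
  \sw_(a, b <- comul \1) f a (eps_t b) = tlift f (comul \1).
Proof. by move=> fB; rewrite -[in RHS]comul1_eps_t tlift_tmap. Qed.

Lemma comul_eps_s h : \sw_(h1, h2 <- comul h) (h1 ** eps_s h2) = h.
Proof.
rewrite -[RHS]counitr -[in RHS](amulx1 h) sw_comulM; last by mlin.
apply: eq_tlift => x y; rewrite /eps_s mul_swr.
by apply: eq_tlift => a b; rewrite scale_mulr.
Qed.

(** Insert Delta(1) before Delta(h) and expand eps_t. The two copies of Delta(1) merge, leaving 1_1
    h_1 eps(1_2 h_2) (x) 1_3, where the counit restores 1_1 h. The mirror image is [sw_eps_sl]. *)
Lemma sw_eps_tr W (f : H -> H -> W) h : bilinear_for *:%R *:%R f ->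
  \sw_(h1, h2 <- comul h) f h1 (eps_t h2) = \sw_(a, b <- comul \1) f (a ** h) b.
Proof.
move=> fB; rewrite -[in LHS](amul1x h) sw_comulM; last by mlin.
transitivity (\sw_(x, y <- comul h) \sw_(a, b <- comul \1) \sw_(c, d <- comul \1)
    (counit (c ** b ** y) *: f (a ** x) d)).
  rewrite tlift_swap; apply: eq_tlift => x y; apply: eq_tlift => a b.
  have L : linear (f (a ** x)) by mlin.
  rewrite /eps_t (comp_tlift _ _ L); apply: eq_tlift => c d.
  by rewrite (linZ _ _ L) amulA.
transitivity (\sw_(x, y <- comul h) \sw_(a, b <- comul \1) \sw_(c, d <- comul a)
    (counit (d ** y) *: f (c ** x) b)).
  apply: eq_tlift => x y.
  rewrite -(@sw_comul1r _ (fun a m d => counit (m ** y) *: f (a ** x) d)); last by mlin.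
  by rewrite -sw_coA //; mlin.
rewrite tlift_swap; apply: eq_tlift => a b.
rewrite -[RHS](@counit_swr _ (fun z => f z b)); last by mlin.
by rewrite sw_comulM 1?[LHS]tlift_swap; last by mlin.
Qed.
Lemma sw_eps_sl W (f : H -> H -> W) h : bilinear_for *:%R *:%R f ->
  \sw_(h1, h2 <- comul h) f (eps_s h1) h2 = \sw_(a, b <- comul \1) f a (h ** b).
Proof.
move=> fB; rewrite -[in LHS](amulx1 h) sw_comulM; last by mlin.
transitivity (\sw_(x, y <- comul h) \sw_(c, d <- comul \1) \sw_(a, b <- comul \1)
    (counit (x ** (a ** d)) *: f c (y ** b))).
  apply: eq_tlift => x y; rewrite tlift_swap; apply: eq_tlift => a b.
  have L : linear (f^~ (y ** b)) by mlin.
  rewrite /eps_s (comp_tlift _ _ L); apply: eq_tlift => c d.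
  by rewrite (linZ _ _ L) amulA.
transitivity (\sw_(x, y <- comul h) \sw_(a, b <- comul \1) \sw_(c, d <- comul b)
    (counit (x ** c) *: f a (y ** d))).
  apply: eq_tlift => x y.
  by rewrite -(@sw_comul1r _ (fun c m b => counit (x ** m) *: f c (y ** b))) //; mlin.
rewrite tlift_swap; apply: eq_tlift => a b.
rewrite -[RHS](@counit_swl _ (fun z => f a z)); last by mlin.
by rewrite sw_comulM; last by mlin.
Qed.

(** Both sides equal eps(1'_1 h 1_2) 1_1 (x) 1'_2, because the counit of a triple product splits
    over the middle factor in either order. *)
Lemma sw_eps_st W (f : H -> H -> W) h : bilinear_for *:%R *:%R f ->
  \sw_(h1, h2 <- comul h) f (eps_s h1) (eps_t h2) =
  \sw_(h1, h2 <- comul h) f (eps_s h2) (eps_t h1).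
Proof.
move=> fB.
have E x y : f (eps_s x) (eps_t y) = \sw_(a, b <- comul \1) \sw_(c, d <- comul \1)
    ((counit (c ** y) * counit (x ** b)) *: f a d).
  have L : linear (f^~ (eps_t y)) by mlin.
  rewrite {1}/eps_s (comp_tlift _ _ L); apply: eq_tlift => a b; rewrite (linZ _ _ L).
  have L' : linear (f a) by mlin.
  rewrite /eps_t (comp_tlift _ _ L') scale_sw; apply: eq_tlift => c d.
  by rewrite (linZ _ _ L') scalerA mulrC.
under eq_tlift => x y do rewrite E.
under [RHS]eq_tlift => x y do rewrite E.
rewrite [LHS]tlift_swap [RHS]tlift_swap; apply: eq_tlift => a b.
rewrite [LHS]tlift_swap [RHS]tlift_swap; apply: eq_tlift => c d.
(* The scalar coefficient is itself a Sweedler sum, valued in [k^o], so that the counit axioms apply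
   to it. *)
have L : linear (fun r : k^o => r *: f a d) by move=> r s t; rewrite scalerDl scalerA.
rewrite -!(comp_tlift _ _ L) -counitM21 counitM12; congr (_ *: _).
Qed.
End WeakHopf.

(** * The antipode reverses products and coproducts *)

Section Antipode.
Variables (k : fieldType) (H : weakHopfAlgType k).
Implicit Types (g h x y z : H) (W : lmodType k).
Local Notation S := (@antipode k H).

Lemma sw_antipoder W (L : H -> W) h : linear L ->
  \sw_(h1, h2 <- comul h) L (h1 ** S h2) = L (eps_t h).
Proof. by move=> LL; rewrite -(comp_tlift _ _ LL) antipoder. Qed.
Lemma sw_antipodel W (L : H -> W) h : linear L ->
  \sw_(h1, h2 <- comul h) L (S h1 ** h2) = L (eps_s h).
Proof. by move=> LL; rewrite -(comp_tlift _ _ LL) antipodel. Qed.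

(** The axiom [antipode3] with h_2 S(h_3) contracted to eps_t. Contracting the first two factors
    instead gives [sw_eps_s_antipode]. *)
Lemma sw_antipode_eps_t W (L : H -> W) h : linear L ->
  \sw_(h1, h2 <- comul h) L (S h1 ** eps_t h2) = L (S h).
Proof.
move=> LL; rewrite -[in RHS]antipode3 (comp_tlift _ _ LL); apply: eq_tlift => x y.
rewrite (comp_tlift _ _ LL) -(@sw_antipoder _ (fun z => L (S x ** z))); last by mlin.
by apply: eq_tlift => u v; rewrite amulA.
Qed.
Lemma sw_eps_s_antipode W (L : H -> W) h : linear L ->
  \sw_(h1, h2 <- comul h) L (eps_s h1 ** S h2) = L (S h).
Proof.
move=> LL; rewrite -[in RHS]antipode3 (comp_tlift _ _ LL).
transitivity (\sw_(h1, h2 <- comul h) \sw_(u, v <- comul h1) L (S u ** v ** S h2)).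
  by apply: eq_tlift => x y; rewrite (@sw_antipodel _ (fun z => L (z ** S y))) //; mlin.
rewrite sw_coA; last by mlin.
by apply: eq_tlift => x y; rewrite (comp_tlift _ _ LL).
Qed.

(** Replace h by z = eps_t(h). Since Delta(gz) = g_1 z (x) g_2 for z in H_t, the product (gz)_1
    S((gz)_2) has the stated form. *)
Lemma eps_tM g h : eps_t (g ** h) = \sw_(g1, g2 <- comul g) (g1 ** eps_t h ** S g2).
Proof.
rewrite -eps_tMr -[LHS]antipoder (sw_comul_tr g (target_eps h)) //; mlin.
Qed.
Lemma eps_sM g h : eps_s (g ** h) = \sw_(h1, h2 <- comul h) (S h1 ** (eps_s g ** h2)).
Proof.
rewrite -eps_sMl -[LHS]antipodel sw_comul_sl //; mlin.
Qed.

(* S(gh) = S(h_1) eps_s(g_1) eps_t(h_2) S(g_2); now swap the two middle factors. *)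
Lemma antipodeM g h : S (g ** h) = S h ** S g.
Proof.
rewrite -[LHS](@sw_eps_s_antipode _ (fun z => z)) // sw_comulM; last by mlin.
transitivity (\sw_(g1, g2 <- comul g) \sw_(h1, h2 <- comul h) \sw_(x, y <- comul h2)
    (S h1 ** (eps_s g1 ** x ** S (g2 ** y)))).
  apply: eq_tlift => g1 g2.
  rewrite -(@sw_coA _ _ _ (fun a b c => S a ** (eps_s g1 ** b ** S (g2 ** c)))); last by mlin.
  apply: eq_tlift => h1 h2; rewrite /= eps_sM mul_swl.
  by apply: eq_tlift => x y; rewrite !amulA.
(* Opening eps_s(g_1) as S(g_1) g_2 puts g_2 h_2 next to S(g_3 h_3), and these two contract to
   eps_t. *)
transitivity (\sw_(h1, h2 <- comul h) \sw_(g1, g2 <- comul g)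
    (S h1 ** (S g1 ** eps_t (g2 ** h2)))).
  rewrite tlift_swap; apply: eq_tlift => h1 h2.
  transitivity (\sw_(g1, g2 <- comul g) \sw_(u, v <- comul g1) \sw_(x, y <- comul h2)
     (S h1 ** (S u ** (v ** x ** S (g2 ** y))))).
    apply: eq_tlift => g1 g2; rewrite [RHS]tlift_swap; apply: eq_tlift => x y.
    rewrite -(@sw_antipodel _ (fun z => S h1 ** (z ** x ** S (g2 ** y)))); last by mlin.
    by apply: eq_tlift => u v; rewrite !amulA.
  rewrite (@sw_coA _ _ _ (fun a b c => \sw_(x, y <- comul h2)
    (S h1 ** (S a ** (b ** x ** S (c ** y)))))); last by mlin.
  apply: eq_tlift => g1 g2.
  rewrite -(@sw_antipoder _ (fun z => S h1 ** (S g1 ** z))); last by mlin.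
  by rewrite sw_comulM; last by mlin.
(* By [eps_tM], eps_t(g_2 h_2) = g_2 eps_t(h_2) S(g_3), and S(g_1) g_2 contracts back to eps_s. *)
transitivity (\sw_(h1, h2 <- comul h) \sw_(g1, g2 <- comul g)
    ((S h1 ** eps_t h2) ** (eps_s g1 ** S g2))).
  apply: eq_tlift => h1 h2.
  transitivity (\sw_(g1, g2 <- comul g) \sw_(u, v <- comul g2)
     (S h1 ** (S g1 ** u ** eps_t h2 ** S v))).
    apply: eq_tlift => g1 g2; rewrite eps_tM !mul_swr.
    by apply: eq_tlift => u v; rewrite !amulA.
  rewrite -(@sw_coA _ _ _ (fun a b c => S h1 ** (S a ** b ** eps_t h2 ** S c))); last by mlin.
  apply: eq_tlift => g1 g2.
  rewrite (@sw_antipodel _ (fun z => S h1 ** (z ** eps_t h2 ** S g2))); last by mlin.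
  by rewrite -eps_ts_comm !amulA.
rewrite -(@sw_antipode_eps_t _ (fun z => z ** S g)); last by mlin.
apply: eq_tlift => h1 h2.
by rewrite (@sw_eps_s_antipode _ (amul (S h1 ** eps_t h2))); last by mlin.
Qed.

Lemma sw_comul_eps_t W (f : H -> H -> W) h : bilinear_for *:%R *:%R f ->
  tlift f (comul (eps_t h)) = \sw_(a, b <- comul \1) f (a ** eps_t h) b.
Proof.
move=> fB; rewrite -{1}[eps_t h]amul1x sw_comul_tr //; exact: target_eps.
Qed.

(** Write Delta(eps_t(h)) = 1_1 h_1 S(h_2) (x) 1_2 and absorb Delta(1) into h_1 by [sw_eps_tr]. *)
Lemma sw_comul_eps_t4 W (f : H -> H -> W) h : bilinear_for *:%R *:%R f ->
  tlift f (comul (eps_t h)) =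
  \sw_(h1, h2 <- comul h) \sw_(x, y <- comul h2) f (h1 ** S y) (eps_t x).
Proof.
move=> fB; rewrite sw_comul_eps_t //.
rewrite -(@sw_coA _ _ _ (fun a b c => f (a ** S c) (eps_t b))); last by mlin.
transitivity (\sw_(h1, h2 <- comul h) \sw_(a, b <- comul \1) f (a ** h1 ** S h2) b).
  rewrite tlift_swap; apply: eq_tlift => a b.
  rewrite -(@sw_antipoder _ (fun z => f (a ** z) b)); last by mlin.
  by apply: eq_tlift => x y; rewrite amulA.
apply: eq_tlift => h1 h2.
by rewrite (@sw_eps_tr _ _ _ (fun a b => f (a ** S h2) b)); last by mlin.
Qed.
Lemma sw_comul_eps_s4 W (f : H -> H -> W) h : bilinear_for *:%R *:%R f ->
  tlift f (comul (eps_s h)) =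
  \sw_(h1, h2 <- comul h) \sw_(x, y <- comul h2) f (eps_s x) (S h1 ** y).
Proof.
move=> fB; rewrite sw_comul_eps_sl //.
transitivity (\sw_(h1, h2 <- comul h) \sw_(a, b <- comul \1) f a (S h1 ** (h2 ** b))).
  rewrite tlift_swap; apply: eq_tlift => a b.
  rewrite -(@sw_antipodel _ (fun z => f a (z ** b))); last by mlin.
  by apply: eq_tlift => x y; rewrite amulA.
apply: eq_tlift => h1 h2.
by rewrite (@sw_eps_sl _ _ _ (fun a b => f a (S h1 ** b))); last by mlin.
Qed.

(** The expected value of Delta(S h). As in the uniqueness of convolution inverses, it is compared
    with Delta(S h) through their common product with Delta. *)
Let Y h : H \ox H := \sw_(h1, h2 <- comul h) (S h2 \ox S h1).

Lemma comul_eps_s_antipode h :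
  comul (eps_s h) = \sw_(h1, h2 <- comul h) (Y h1 ** comul h2).
Proof.
rewrite -[LHS]tlift_id sw_comul_eps_s4; last by mlin.
transitivity (\sw_(h1, h2 <- comul h) \sw_(x, y <- comul h2) \sw_(u, v <- comul y)
    ((S x ** u) \ox (S h1 ** v))).
  apply: eq_tlift => h1 h2.
  rewrite -(@sw_coA _ _ _ (fun a b c => (S a ** b) \ox (S h1 ** c))); last by mlin.
  apply: eq_tlift => x y.
  by rewrite (@sw_antipodel _ (fun z => z \ox (S h1 ** y))); last by mlin.
rewrite -(@sw_coA _ _ _ (fun a b c => \sw_(u, v <- comul c)
  ((S b ** u) \ox (S a ** v)))); last by mlin.
apply: eq_tlift => h1 h2; rewrite /Y mul_swl; apply: eq_tlift => a b.
rewrite -[in RHS](tlift_id (comul h2)) mul_swr; apply: eq_tlift => u v.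
by rewrite tens_mul.
Qed.

(** Delta(S h) = Delta(eps_s(h_1)) Delta(S h_2) = Y(h_1) Delta(h_2) Delta(S h_3), and the last two
    factors contract to Delta(eps_t). *)
Lemma comul_antipode_eps_t h :
  comul (S h) = \sw_(h1, h2 <- comul h) (Y h1 ** comul (eps_t h2)).
Proof.
rewrite -(@sw_eps_s_antipode _ comul); last exact: linearP.
transitivity (\sw_(h1, h2 <- comul h) \sw_(a, b <- comul h1)
   (Y a ** (comul b ** comul (S h2)))).
  apply: eq_tlift => h1 h2; rewrite comulM comul_eps_s_antipode mul_swl.
  by apply: eq_tlift => a b; rewrite amulA.
have YL : linear Y by rewrite /Y; mlin.
rewrite (@sw_coA _ _ _ (fun a b c => Y a ** (comul b ** comul (S c)))); last by mlin.
apply: eq_tlift => h1 h2.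
rewrite -(@sw_antipoder _ (fun z => Y h1 ** comul z)); last by mlin.
by apply: eq_tlift => a b; rewrite comulM.
Qed.

(* Delta(S h) = eps_s(h_2) S(h_4) (x) S(h_1) eps_t(h_3), where h_2 and h_3 may be
   exchanged by [sw_eps_st]. *)
Lemma antipode_comul h : comul (S h) = \sw_(h1, h2 <- comul h) (S h2 \ox S h1).
Proof.
rewrite comul_antipode_eps_t.
transitivity (\sw_(h1, h2 <- comul h) \sw_(u, v <- comul h1)
   \sw_(a, r <- comul h2) \sw_(c, d <- comul r)
     ((S v ** a ** S d) \ox (S u ** eps_t c))).
  apply: eq_tlift => h1 h2; rewrite /Y mul_swl; apply: eq_tlift => u v.
  rewrite -[comul (eps_t h2)]tlift_id sw_comul_eps_t4; last by mlin.
  rewrite mul_swr; apply: eq_tlift => a r; rewrite mul_swr.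
  by apply: eq_tlift => c d; rewrite tens_mul amulA.
rewrite (@sw_coA _ _ _ (fun u v w => \sw_(a, r <- comul w) \sw_(c, d <- comul r)
     ((S v ** a ** S d) \ox (S u ** eps_t c)))); last by mlin.
(* After the exchange, eps_s stands on the leg adjacent to the last antipode and is absorbed by
   it. *)
transitivity (\sw_(u, s <- comul h) \sw_(m, r <- comul s) (S r \ox (S u ** eps_t m))).
  apply: eq_tlift => u s.
  rewrite -(@sw_coA _ _ _ (fun v a r => \sw_(c, d <- comul r)
     ((S v ** a ** S d) \ox (S u ** eps_t c)))); last by mlin.
  transitivity (\sw_(s1, s2 <- comul s) \sw_(c, d <- comul s2)
      ((eps_s s1 ** S d) \ox (S u ** eps_t c))).
    apply: eq_tlift => s1 s2.
    rewrite -(@sw_antipodel _ (fun z => \sw_(c, d <- comul s2)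
      ((z ** S d) \ox (S u ** eps_t c)))); last by mlin.
    by [].
  rewrite -(@sw_coA _ _ _ (fun m c d => (eps_s m ** S d) \ox (S u ** eps_t c))); last by mlin.
  under eq_tlift => s1 s2.
    rewrite (@sw_eps_st _ _ _ (fun x y => (x ** S s2) \ox (S u ** y))); last by mlin.
    over.
  rewrite (@sw_coA _ _ _ (fun m c d => (eps_s c ** S d) \ox (S u ** eps_t m))); last by mlin.
  apply: eq_tlift => m r.
  by rewrite (@sw_eps_s_antipode _ (fun z => z \ox (S u ** eps_t m))); last by mlin.
rewrite -(@sw_coA _ _ _ (fun u m r => S r \ox (S u ** eps_t m))); last by mlin.
apply: eq_tlift => p r.
by rewrite (@sw_antipode_eps_t _ (fun z => S r \ox z)); last by mlin.
Qed.
End Antipode.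

(** * Comodule algebras *)

Section TensorMapLemmas.
Variable k : fieldType.

(** Common source of the Sweedler forms of right coassociativity, left coassociativity and
    bicomodule compatibility. *)
Lemma sw_assoc (P Q U V W X : lmodType k) (F : {linear P -> (U \ox V)%type})
    (G : {linear Q -> (V \ox W)%type}) s t (f : U -> V -> W -> X) :
  trilinear f -> tassoc (tmap F idfun s) = tmap idfun G t ->
  \sw_(p, w <- s) \sw_(u, v <- F p) f u v w = \sw_(u, q <- t) \sw_(v, w <- G q) f u v w.
Proof.
move=> fT /(congr1 (tlift (fun x yz => tlift (f x) yz))).
have fB x : bilinear_for *:%R *:%R (f x) by mlin.
rewrite tlift_tassoc; last by mlin; exact: fB.
rewrite !tlift_tmap; try by [mlin; exact: fB | mlin].
move=> <-; apply: eq_tlift => p w; apply: eq_tlift => u v.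
by rewrite tlift_tens.
Qed.

Lemma tmap_tens (U V U' V' : lmodType k) (f : {linear U -> U'}) (g : {linear V -> V'}) u v :
  tmap f g (u \ox v) = f u \ox g v.
Proof. by rewrite /tmap tlift_tens; last by mlin. Qed.

Lemma linear_bundle (U V : lmodType k) (f : U -> V) :
  linear f -> exists L : {linear U -> V}, L =1 f.
Proof.
move=> fL; pose LM := GRing.isLinear.Build k U V _ f fL.
by exists (HB.pack f LM : {linear U -> V}).
Qed.

(** The universal property of the quotient. The lift is [f] on chosen representatives, independent
    of the choice because [f] kills the span of [G]. *)
Lemma lquot_lift (V W : lmodType k) (G : V -> Prop) (f : V -> W) :
  linear f -> (forall x, G x -> f x = 0) ->
  exists L : {linear lquot G -> W}, forall x, L (lproj G x) = f x.
Proof.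
move=> fL f0.
have E x : f (repr (lproj G x)) = f x.
  apply/eqP; rewrite -subr_eq0 -(linB _ _ fL); apply/eqP.
  have /lproj_eq : lproj G (repr (lproj G x)) = lproj G x.
    by rewrite /lproj generic_quotient.reprK.
  by elim=> [|c g y Gg _ IH]; [exact: lin0 | rewrite fL IH f0 // scaler0 add0r].
have gL : linear (fun y : lquot G => f (repr y)).
  move=> c y z; have [u ->] := lproj_surj y; have [w ->] := lproj_surj z.
  by rewrite -linearP !E fL.
by have [L LE] := linear_bundle gL; exists L => x; rewrite LE E.
Qed.
End TensorMapLemmas.

Section ComoduleAlgebra.
Variables (k : fieldType) (H : weakHopfAlgType k) (B : unitalAlgType k).
Variables (rho : {linear B -> (B \ox H)%type}) (lam : {linear B -> (H \ox B)%type}).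
Hypothesis Bco : bicomodule_algebra rho lam.
Let rP := bicomod_right Bco.
Let lP := bicomod_left Bco.
Implicit Type W : lmodType k.

Lemma sw_rcoA W (f : B -> H -> H -> W) b : trilinear f ->
  \sw_(b0, b1 <- rho b) \sw_(x, y <- rho b0) f x y b1 =
  \sw_(b0, b1 <- rho b) \sw_(h1, h2 <- comul b1) f b0 h1 h2.
Proof. by move=> fT; apply: sw_assoc fT (rcoactA rP b). Qed.
Lemma sw_lcoA W (f : H -> H -> B -> W) b : trilinear f ->
  \sw_(x, b0 <- lam b) \sw_(h1, h2 <- comul x) f h1 h2 b0 =
  \sw_(x, b0 <- lam b) \sw_(y, z <- lam b0) f x y z.
Proof. by move=> fT; apply: sw_assoc fT (esym (lcoactA lP b)). Qed.
Lemma sw_bicoA W (f : H -> B -> H -> W) b : trilinear f ->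
  \sw_(b0, b1 <- rho b) \sw_(x, y <- lam b0) f x y b1 =
  \sw_(x, b0 <- lam b) \sw_(y, z <- rho b0) f x y z.
Proof. by move=> fT; apply: sw_assoc fT (bicomodA Bco b). Qed.

Lemma sw_rcoactM W (f : B -> H -> W) a b : bilinear_for *:%R *:%R f ->
  tlift f (rho (a ** b)) =
  \sw_(a0, a1 <- rho a) \sw_(b0, b1 <- rho b) f (a0 ** b0) (a1 ** b1).
Proof. by move=> fB; rewrite (rcoactM rP) tlift_mul. Qed.
Lemma sw_lcoactM W (f : H -> B -> W) a b : bilinear_for *:%R *:%R f ->
  tlift f (lam (a ** b)) =
  \sw_(x, a0 <- lam a) \sw_(y, b0 <- lam b) f (x ** y) (a0 ** b0).
Proof. by move=> fB; rewrite (lcoactM lP) tlift_mul. Qed.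

Variable v : {linear H -> B}.
Hypothesis vP : bicomodule_algebra_morphism (@comul k H) (@comul k H) rho lam v.

Lemma sw_rcoact_v W (f : B -> H -> W) h : bilinear_for *:%R *:%R f ->
  tlift f (rho (v h)) = \sw_(h1, h2 <- comul h) f (v h1) h2.
Proof. by move=> fB; rewrite (morph_rcoact vP) tlift_tmap. Qed.
Lemma sw_lcoact_v W (f : H -> B -> W) h : bilinear_for *:%R *:%R f ->
  tlift f (lam (v h)) = \sw_(h1, h2 <- comul h) f h1 (v h2).
Proof. by move=> fB; rewrite (morph_lcoact vP) tlift_tmap. Qed.

(** Here rho(v(eps_s h)) = v(1_1) (x) eps_s(h) 1_2, and v(1_1) (x) 1_2 = rho(1) is absorbed by
    rho(b). *)
Lemma sw_rcoact_sl W (f : B -> H -> W) h b : bilinear_for *:%R *:%R f ->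
  tlift f (rho (v (eps_s h) ** b)) = \sw_(b0, b1 <- rho b) f b0 (eps_s h ** b1).
Proof.
move=> fB; rewrite -[in RHS](amul1x b) -(morph_one vP).
rewrite !sw_rcoactM; [|mlin..].
rewrite !sw_rcoact_v; [|mlin..].
rewrite sw_comul_eps_sl; last by mlin.
by apply: eq_tlift => c d; apply: eq_tlift => b0 b1; rewrite amulA.
Qed.
Lemma sw_rcoact_sr W (f : B -> H -> W) h b : bilinear_for *:%R *:%R f ->
  tlift f (rho (b ** v (eps_s h))) = \sw_(b0, b1 <- rho b) f b0 (b1 ** eps_s h).
Proof.
move=> fB; rewrite -[in RHS](amulx1 b) -(morph_one vP).
rewrite !sw_rcoactM; [|mlin..].
apply: eq_tlift => b0 b1.
rewrite !sw_rcoact_v; [|mlin..].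
rewrite sw_comul_eps_sr; last by mlin.
by apply: eq_tlift => c d; rewrite amulA.
Qed.

Lemma sw_rcounit W (L : B -> W) b : linear L ->
  \sw_(b0, b1 <- rho b) (counit b1 *: L b0) = L b.
Proof.
move=> LL; rewrite -[in RHS](rcoact_counit rP b) (comp_tlift _ _ LL).
by apply: eq_tlift => x y; rewrite (linZ _ _ LL).
Qed.

Section Coinvariant.
Variable a : B.
Hypothesis aA : a \in coinv_pred rho.

Lemma sw_coinv_eps W (f : B -> H -> W) : bilinear_for *:%R *:%R f ->
  tlift f (rho a) = \sw_(a0, a1 <- rho a) f a0 (eps_t a1).
Proof. by move=> fB; rewrite {1}(eqP aA) tlift_tmap. Qed.

(* Both sides equal a_0 eps(eps_s(h) a_1), because a_1 may be replaced by
   eps_t(a_1), which commutes with eps_s(h). *)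
Lemma coinv_comm h : v (eps_s h) ** a = a ** v (eps_s h).
Proof.
rewrite -[LHS](rcoact_counit rP) -[RHS](rcoact_counit rP).
rewrite sw_rcoact_sl ?sw_rcoact_sr; [|mlin..].
rewrite sw_coinv_eps; last by mlin.
rewrite [RHS]sw_coinv_eps; last by mlin.
by apply: eq_tlift => a0 a1; rewrite eps_ts_comm.
Qed.

(** Coinvariance gives v(1_1) a (x) 1_2. As 1_1 may be replaced by eps_s(1_1), [coinv_comm] moves a
    to the left. *)
Lemma sw_coinv W (f : B -> H -> W) : bilinear_for *:%R *:%R f ->
  tlift f (rho a) = \sw_(e1, e2 <- comul \1) f (a ** v e1) e2.
Proof.
move=> fB.
have /(coinvP rP) -> := aA.
rewrite tlift_mul // -{1}(morph_one vP) sw_rcoact_v; last by mlin.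
rewrite -sw_comul1_eps_s; last by mlin.
rewrite -[RHS]sw_comul1_eps_s; last by mlin.
apply: eq_tlift => c d; rewrite tlift_tens; last by mlin.
by rewrite coinv_comm amulx1.
Qed.

Lemma sw_coinvMl W (f : B -> H -> W) b : bilinear_for *:%R *:%R f ->
  tlift f (rho (a ** b)) = \sw_(b0, b1 <- rho b) f (a ** b0) b1.
Proof.
move=> fB; rewrite sw_rcoactM // sw_coinv; last by mlin.
rewrite -[in RHS](amul1x b) -(morph_one vP) sw_rcoactM; last by mlin.
rewrite sw_rcoact_v; last by mlin.
by apply: eq_tlift => c d; apply: eq_tlift => b0 b1; rewrite amulA.
Qed.

(** Here the form rho(a) = rho(1)(a (x) 1) is the convenient one, since rho(v h) absorbs rho(1) on
    the right. *)
Lemma sw_coinvMr W (f : B -> H -> W) h : bilinear_for *:%R *:%R f ->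
  tlift f (rho (v h ** a)) = \sw_(h1, h2 <- comul h) f (v h1 ** a) h2.
Proof.
move=> fB; rewrite sw_rcoactM // sw_rcoact_v; last by mlin.
rewrite -[in RHS](amulx1 h) sw_comulM; last by mlin.
apply: eq_tlift => h1 h2; have /(coinvP rP) -> := aA.
rewrite tlift_mul; last by mlin.
rewrite -{1}(morph_one vP) sw_rcoact_v; last by mlin.
apply: eq_tlift => c d; rewrite tlift_tens; last by mlin.
by rewrite amulx1 (morph_mul vP) amulA.
Qed.
End Coinvariant.

(** * The projection [E] onto the coinvariants *)

Local Notation E := (coinv_E rho v).

Lemma coinv_E_linear : linear E.
Proof. rewrite /coinv_E; mlin. Qed.

Lemma eps_t1 : eps_t \1 = \1 :> H.
Proof.
by rewrite -[RHS]counitl; apply: eq_tlift => x y; rewrite amulx1.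
Qed.

Lemma coinv_E_id a : a \in coinv_pred rho -> E a = a.
Proof.
move=> aA; rewrite /coinv_E (sw_coinv aA); last by mlin.
transitivity (a ** v (eps_t \1)); last by rewrite eps_t1 (morph_one vP) amulx1.
rewrite -(@sw_antipoder _ _ _ (fun z => a ** v z)); last by mlin.
by apply: eq_tlift => x y; rewrite (morph_mul vP) amulA.
Qed.

Lemma coinv_E_mull a b : a \in coinv_pred rho -> E (a ** b) = a ** E b.
Proof.
move=> aA; rewrite /coinv_E (sw_coinvMl aA) ?mul_swr; last by mlin.
by apply: eq_tlift => x y; rewrite amulA.
Qed.

Lemma coinv_E_v h : E (v h) = v (eps_t h).
Proof.
rewrite /coinv_E sw_rcoact_v; last by mlin.
rewrite -(@sw_antipoder _ _ _ v); last by mlin.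
by apply: eq_tlift => x y; rewrite (morph_mul vP).
Qed.

Lemma coinv_E_mulr a h : a \in coinv_pred rho ->
  E (v h ** a) = \sw_(h1, h2 <- comul h) (v h1 ** a ** v (antipode h2)).
Proof. by move=> aA; rewrite /coinv_E (sw_coinvMr aA); last by mlin. Qed.

(** Since Delta(S h) = S(h_2) (x) S(h_1), rho(b_0 v(S b_1)) = b_0 v(S b_3) (x) b_1 S(b_2). The
    second leg is an eps_t, whence [coinv_E_in]. *)
Lemma rcoact_coinv_E b :
  rho (E b) = \sw_(b0, b1 <- rho b) \sw_(h1, h2 <- comul b1)
                ((b0 ** v (antipode h2)) \ox eps_t h1).
Proof.
transitivity (\sw_(b0, b1 <- rho b) \sw_(x, y <- rho b0) \sw_(h1, h2 <- comul b1)
    ((x ** v (antipode h2)) \ox (y ** antipode h1))).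
  rewrite /coinv_E lin_sw; apply: eq_tlift => b0 b1.
  rewrite -[LHS]tlift_id sw_rcoactM; last by mlin.
  apply: eq_tlift => x y; rewrite sw_rcoact_v; last by mlin.
  rewrite antipode_comul sw_sw; last by mlin.
  by apply: eq_tlift => h1 h2; rewrite tlift_tens; last by mlin.
rewrite (@sw_rcoA _ (fun x y z => \sw_(h1, h2 <- comul z)
  ((x ** v (antipode h2)) \ox (y ** antipode h1)))); last by mlin.
apply: eq_tlift => b0 b1.
rewrite -(@sw_coA _ _ _ (fun y h1 h2 =>
  (b0 ** v (antipode h2)) \ox (y ** antipode h1))); last by mlin.
apply: eq_tlift => s h2.
by rewrite (@sw_antipoder _ _ _ (fun z => (b0 ** v (antipode h2)) \ox z)); last by mlin.
Qed.

Lemma coinv_E_in b : E b \in coinv_pred rho.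
Proof.
apply/eqP; rewrite rcoact_coinv_E.
have L : linear (tmap (@idfun B) (@eps_t k H)) by rewrite /tmap; mlin.
rewrite (comp_tlift _ _ L); apply: eq_tlift => b0 b1.
rewrite (comp_tlift _ _ L); apply: eq_tlift => h1 h2.
by rewrite tmap_tens /= eps_t_idem.
Qed.

(** Bicomodule compatibility lets rho act before lam. With rho(a) = a v(1_1) (x) 1_2 the result is
    a_<-1> 1_1 (x) a_<0> v(1_2 S(1_3)). Here 1_2 S(1_3) = eps_t(1_2) may be replaced by 1_2, leaving
    lam(a) lam(1) = lam(a). *)
Lemma lcoact_coinv_E a : a \in coinv_pred rho -> tmap idfun E (lam a) = lam a.
Proof.
move=> aA; transitivity (\sw_(a0, a1 <- rho a) \sw_(x, y <- lam a0)
    (x \ox (y ** v (antipode a1)))).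
  rewrite (@sw_bicoA _ (fun x y z => x \ox (y ** v (antipode z)))); last by mlin.
  by apply: eq_tlift => x y; rewrite /coinv_E tens_swr.
rewrite (sw_coinv aA); last by mlin.
transitivity (\sw_(x, y <- lam a) \sw_(e1, e2 <- comul \1) \sw_(c, d <- comul e1)
    ((x ** c) \ox (y ** v d ** v (antipode e2)))).
  rewrite [RHS]tlift_swap; apply: eq_tlift => e1 e2.
  rewrite sw_lcoactM; last by mlin.
  by apply: eq_tlift => x y; rewrite sw_lcoact_v; last by mlin.
rewrite -[RHS]tlift_id -{2}(amulx1 a) -(morph_one vP) sw_lcoactM; last by mlin.
apply: eq_tlift => x y; rewrite sw_lcoact_v; last by mlin.
rewrite (@sw_coA _ _ _ (fun c d s => (x ** c) \ox (y ** v d ** v (antipode s)))); last by mlin.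
rewrite -[RHS]sw_comul1_eps_t; last by mlin.
apply: eq_tlift => c d.
rewrite -(@sw_antipoder _ _ _ (fun z => (x ** c) \ox (y ** v z))); last by mlin.
by apply: eq_tlift => s t; rewrite (morph_mul vP) amulA.
Qed.

Lemma coinv_E_recons b : \sw_(b0, b1 <- rho b) (E b0 ** v b1) = b.
Proof.
transitivity (\sw_(b0, b1 <- rho b) (b0 ** v (eps_s b1))).
  transitivity (\sw_(b0, b1 <- rho b) \sw_(x, y <- rho b0) (x ** v (antipode y) ** v b1)).
    by apply: eq_tlift => b0 b1; rewrite /coinv_E mul_swl.
  rewrite (@sw_rcoA _ (fun x y z => x ** v (antipode y) ** v z)); last by mlin.
  apply: eq_tlift => b0 b1.
  rewrite -(@sw_antipodel _ _ _ (fun z => b0 ** v z)); last by mlin.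
  by apply: eq_tlift => x y; rewrite (morph_mul vP) amulA.
(* The counit axiom for b = b v(1) reads b = b_0 v(1_1) eps(b_1 1_2), which is b_0 v(eps_s(b_1)). *)
rewrite -[RHS](rcoact_counit rP) -[in RHS](amulx1 b) -(morph_one vP).
rewrite sw_rcoactM; last by mlin.
apply: eq_tlift => b0 b1; rewrite sw_rcoact_v; last by mlin.
have L : linear (fun z => b0 ** v z) by mlin.
rewrite eps_sE (comp_tlift _ _ L); apply: eq_tlift => c d.
by rewrite (linZ _ _ L).
Qed.
End ComoduleAlgebra.

Section TensorMapAlgebra.
Variable k : fieldType.

Lemma tens_expr (U V W : lmodType k) (z : W) (t : U \ox V) :
  z \ox t = \sw_(x, y <- t) (z \ox (x \ox y)).
Proof.
rewrite -{1}[t]tlift_id; have L : linear (fun s : U \ox V => z \ox s) by mlin.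
exact: (comp_tlift _ _ L).
Qed.

Lemma tens_mulE (A B : unitalAlgType k) (s t : A \ox B) :
  s ** t = \sw_(a, b <- s) \sw_(a', b' <- t) ((a ** a') \ox (b ** b')).
Proof. by []. Qed.

Lemma tmap_tmap (U V U' V' U'' V'' : lmodType k) (f : {linear U -> U'}) (g : {linear V -> V'})
    (f' : {linear U' -> U''}) (g' : {linear V' -> V''}) t :
  tmap f' g' (tmap f g t) = tmap (fun x => f' (f x)) (fun x => g' (g x)) t.
Proof. by rewrite {1}/tmap tlift_tmap; last by mlin. Qed.

Lemma tmapM (A B A' B' : unitalAlgType k) (f : {linear A -> A'}) (g : {linear B -> B'}) s t :
  (forall x y, f (x ** y) = f x ** f y) -> (forall x y, g (x ** y) = g x ** g y) ->
  tmap f g (s ** t) = tmap f g s ** tmap f g t.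
Proof.
move=> fM gM; rewrite /tmap tlift_mul; last by mlin.
rewrite mul_swl; apply: eq_tlift => a b; rewrite mul_swr; apply: eq_tlift => a' b'.
by rewrite tens_mul fM gM.
Qed.

Lemma sw_lcounit (H : weakHopfAlgType k) (B : unitalAlgType k) (rho : {linear B -> (B \ox H)%type})
    (lam : {linear B -> (H \ox B)%type}) (Bco : bicomodule_algebra rho lam)
    (W : lmodType k) (L : B -> W) b : linear L ->
  \sw_(b1, b0 <- lam b) (counit b1 *: L b0) = L b.
Proof.
move=> LL; rewrite -[in RHS](lcoact_counit (bicomod_left Bco) b) (comp_tlift _ _ LL).
by apply: eq_tlift => x y; rewrite (linZ _ _ LL).
Qed.
End TensorMapAlgebra.

(** * Transport of bicomodule algebra structures along an algebra isomorphism *)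

Section Transport.
Variables (k : fieldType) (H : weakHopfAlgType k) (B C : unitalAlgType k).
Variables (rho : {linear B -> (B \ox H)%type}) (lam : {linear B -> (H \ox B)%type}).
Variables (rhoC : {linear C -> (C \ox H)%type}) (lamC : {linear C -> (H \ox C)%type}).
Variables (phi : {linear C -> B}) (psi : {linear B -> C}).
Hypothesis Bco : bicomodule_algebra rho lam.
Hypotheses (phiK : cancel phi psi) (psiK : cancel psi phi).
Hypotheses (phi1 : phi \1 = \1) (phiM : forall x y, phi (x ** y) = phi x ** phi y).
Hypothesis rhoCE : forall x, rhoC x = tmap psi idfun (rho (phi x)).
Hypothesis lamCE : forall x, lamC x = tmap idfun psi (lam (phi x)).
Let rP := bicomod_right Bco.
Let lP := bicomod_left Bco.

Let psiM a b : psi (a ** b) = psi a ** psi b.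
Proof. by rewrite -[a in LHS]psiK -[b in LHS]psiK -phiM phiK. Qed.

Let sw_rhoC (W : lmodType k) (f : C -> H -> W) x : bilinear_for *:%R *:%R f ->
  tlift f (rhoC x) = \sw_(b0, b1 <- rho (phi x)) f (psi b0) b1.
Proof. by move=> fB; rewrite rhoCE tlift_tmap. Qed.
Let sw_lamC (W : lmodType k) (f : H -> C -> W) x : bilinear_for *:%R *:%R f ->
  tlift f (lamC x) = \sw_(b1, b0 <- lam (phi x)) f b1 (psi b0).
Proof. by move=> fB; rewrite lamCE tlift_tmap. Qed.

Lemma transport_right : right_comodule_algebra rhoC.
Proof.
split=> [x|x|x|x y].
- rewrite sw_rhoC; last by mlin.
  by rewrite (sw_rcounit Bco) ?phiK //; mlin.
- rewrite /tmap /tassoc sw_sw; last by mlin.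
  rewrite !sw_rhoC; [|mlin..].
  transitivity (\sw_(b0, b1 <- rho (phi x)) \sw_(c0, c1 <- rho b0) (psi c0 \ox (c1 \ox b1))).
    apply: eq_tlift => b0 b1; rewrite tlift_tens; last by mlin.
    by rewrite sw_rhoC ?psiK //; mlin.
  rewrite (@sw_rcoA _ _ _ _ _ Bco _ (fun b h h' => psi b \ox (h \ox h'))); last by mlin.
  apply: eq_tlift => b0 b1.
  by rewrite [RHS]tens_expr.
(* The product rhoC(1)(x (x) 1) is the image under psi (x) id of rho(1)(phi(x) (x) 1), where the
   axiom for B applies. *)
- rewrite [in LHS]rhoCE phi1 -[x in LHS]phiK -(tmap_tens psi idfun).
  rewrite -(tmapM _ _ psiM) // (rcoact_one rP) /tmap sw_sw; last by mlin.
  rewrite sw_rhoC; last by mlin.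
  by apply: eq_tlift => b h; rewrite tlift_tens; last by mlin.
- by rewrite !rhoCE phiM (rcoactM rP) tmapM.
Qed.

Lemma transport_left : left_comodule_algebra lamC.
Proof.
split=> [x|x|x|x y].
- rewrite sw_lamC; last by mlin.
  by rewrite (sw_lcounit Bco) ?phiK //; mlin.
- rewrite /tmap /tassoc sw_sw; last by mlin.
  rewrite !sw_lamC; [|mlin..].
  transitivity (\sw_(b1, b0 <- lam (phi x)) \sw_(c1, c0 <- lam b0) (b1 \ox (c1 \ox psi c0))).
    apply: eq_tlift => b1 b0; rewrite [LHS]tens_expr.
    by rewrite sw_lamC ?psiK //; mlin.
  rewrite -(@sw_lcoA _ _ _ _ _ Bco _ (fun h h' b => h \ox (h' \ox psi b))); last by mlin.
  apply: eq_tlift => b1 b0.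
  rewrite tlift_tens; last by mlin.
  by [].
- rewrite [in LHS]lamCE phi1 -[x in LHS]phiK -(tmap_tens idfun psi).
  rewrite -(tmapM _ _ _ psiM) // (lcoact_one lP) /tmap sw_sw; last by mlin.
  rewrite sw_lamC; last by mlin.
  by apply: eq_tlift => b h; rewrite tlift_tens; last by mlin.
- by rewrite !lamCE phiM (lcoactM lP) tmapM.
Qed.

Lemma transport_bicomodule : bicomodule_algebra rhoC lamC.
Proof.
split; [exact: transport_right | exact: transport_left |] => x.
rewrite /tmap /tassoc sw_sw; last by mlin.
rewrite sw_rhoC; last by mlin.
rewrite sw_lamC; last by mlin.
transitivity (\sw_(b0, b1 <- rho (phi x)) \sw_(c1, c0 <- lam b0) (c1 \ox (psi c0 \ox b1))).
  apply: eq_tlift => b0 b1; rewrite tlift_tens; last by mlin.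
  by rewrite sw_lamC ?psiK //; mlin.
rewrite (@sw_bicoA _ _ _ _ _ Bco _ (fun h b h' => h \ox (psi b \ox h'))); last by mlin.
apply: eq_tlift => b1 b0; rewrite [RHS]tens_expr.
by rewrite sw_rhoC ?psiK //; mlin.
Qed.

Lemma transport_isomorphism :
  bicomodule_algebra_isomorphism rhoC lamC rho lam phi.
Proof.
split; last by exists psi.
split=> // x.
  by rewrite rhoCE tmap_tmap -[LHS]tlift_id; apply: eq_tlift => a b; rewrite /= psiK.
by rewrite lamCE tmap_tmap -[LHS]tlift_id; apply: eq_tlift => a b; rewrite /= psiK.
Qed.
End Transport.

(** * Coinvariants and the smash product *)

Section Structure.
Variables (k : fieldType) (H : weakHopfAlgType k) (B : unitalAlgType k).
Variables (rho : {linear B -> (B \ox H)%type}) (lam : {linear B -> (H \ox B)%type}).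
Hypothesis Bco : bicomodule_algebra rho lam.
Variable v : {linear H -> B}.
Hypothesis vP : bicomodule_algebra_morphism (@comul k H) (@comul k H) rho lam v.
Implicit Type W : lmodType k.
Let rP := bicomod_right Bco.
Let lP := bicomod_left Bco.
Local Notation A := (coinv (bicomod_right Bco)).
Local Notation E := (coinv_E rho v).

Let vlin : linear (val : A -> B). Proof. by move=> c x y; rewrite linearP. Qed.
Let valM (a b : A) : val (a ** b) = val a ** val b. Proof. by []. Qed.
Let val1 : val (\1 : A) = \1. Proof. by []. Qed.

Definition coinv_proj (b : B) : A := Sub (E b) (coinv_E_in Bco vP b).
Local Notation pr := coinv_proj.

Lemma val_coinv_proj b : val (pr b) = E b. Proof. by []. Qed.
Lemma coinv_proj_val a : pr (val a) = a.
Proof. by apply/val_inj; rewrite val_coinv_proj (coinv_E_id Bco vP) ?(valP a). Qed.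
Lemma coinv_proj_linear : linear pr.
Proof.
move=> c x y; apply/val_inj; rewrite vlin !val_coinv_proj; exact: coinv_E_linear.
Qed.
HB.instance Definition _ := GRing.isLinear.Build k B A _ coinv_proj coinv_proj_linear.
(* The local facts [prL], [lcL] and [tB] below are there for [mlin] to find. *)
Let prL : linear pr := coinv_proj_linear.
Lemma coinv_projM (a : A) b : pr (val a ** b) = a ** pr b.
Proof. by apply/val_inj; rewrite valM !val_coinv_proj (coinv_E_mull Bco vP) ?(valP a). Qed.

(** As H (x) A is not literally a subspace of H (x) B, the restriction of lam is made by projecting
    the second leg; [coinv_lcoact_val] shows that nothing is lost. *)
Definition coinv_lcoact (a : A) : H \ox A := tmap idfun coinv_proj (lam (val a)).
Lemma coinv_lcoact_linear : linear coinv_lcoact.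
Proof. by rewrite /coinv_lcoact /tmap; mlin. Qed.
HB.instance Definition _ := GRing.isLinear.Build k A (H \ox A)%type _
  coinv_lcoact coinv_lcoact_linear.

Let lcL : linear coinv_lcoact := coinv_lcoact_linear.

Lemma coinv_lcoact_val a : tmap idfun val (coinv_lcoact a) = lam (val a).
Proof.
rewrite -[RHS](lcoact_coinv_E Bco vP (valP a)) /coinv_lcoact /tmap sw_sw; last by mlin.
by apply: eq_tlift => x b; rewrite tlift_tens; last by mlin.
Qed.
Lemma sw_coinv_lcoact_val W (f : H -> B -> W) a : bilinear_for *:%R *:%R f ->
  \sw_(x, a0 <- coinv_lcoact a) f x (val a0) = tlift f (lam (val a)).
Proof. by move=> fB; rewrite -coinv_lcoact_val tlift_tmap. Qed.
Lemma sw_coinv_lcoact W (f : H -> A -> W) a : bilinear_for *:%R *:%R f ->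
  tlift f (coinv_lcoact a) = \sw_(x, b <- lam (val a)) f x (pr b).
Proof. by move=> fB; rewrite tlift_tmap. Qed.

(** Each axiom is that of lam with [pr] applied to the leg in A. The unit and product axioms use
    that [pr] is left A-linear. *)
Lemma coinv_left_comodule_algebra : left_comodule_algebra coinv_lcoact.
Proof.
split=> [a|a|a|a b].
- rewrite sw_coinv_lcoact; last by mlin.
  by rewrite (sw_lcounit Bco) ?coinv_proj_val //; exact: coinv_proj_linear.
- rewrite /tassoc {2}/tmap sw_sw; last by mlin.
  transitivity (\sw_(x, b <- lam (val a)) \sw_(y, c <- lam b) (x \ox (y \ox pr c))).
    rewrite -sw_coinv_lcoact_val; last by mlin.
    by apply: eq_tlift => x a0; rewrite tens_swr.
  rewrite -(@sw_lcoA _ _ _ _ _ Bco _ (fun x y b => x \ox (y \ox pr b))); last by mlin.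
  rewrite sw_coinv_lcoact; last by mlin.
  by apply: eq_tlift => x b; rewrite tlift_tens; last by mlin.
- rewrite /coinv_lcoact.
  transitivity (tmap idfun pr ((\1 \ox val a) ** lam (val (\1 : A)))).
    rewrite /tmap mul_swr tlift_mul; last by mlin.
    rewrite tlift_tens; last by mlin.
    by apply: eq_tlift => x b; rewrite tens_mul coinv_projM.
  rewrite (lcoact_one lP) /tmap !sw_sw; [|mlin..].
  by apply: eq_tlift => x b; rewrite !tlift_tens; [|mlin..].
- transitivity (tmap idfun pr (lam (val a ** val b))) => //.
  rewrite (lcoactM lP) /tmap tlift_mul; last by mlin.
  rewrite -sw_coinv_lcoact_val; last by mlin.
  rewrite [RHS]tens_mulE; apply: eq_tlift => x a0.
  rewrite [RHS]sw_coinv_lcoact; last by mlin.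
  by apply: eq_tlift => y c; rewrite coinv_projM.
Qed.

Definition coinv_act (h : H) (a : A) : A := coinv_proj (v h ** val a).

Lemma val_coinv_act h a : val (coinv_act h a) =
  \sw_(h1, h2 <- comul h) (v h1 ** val a ** v (antipode h2)).
Proof. by rewrite val_coinv_proj (coinv_E_mulr Bco vP) ?(valP a). Qed.

Lemma val_coinv_act1 h : val (coinv_act h \1) = v (eps_t h).
Proof. by rewrite val_coinv_proj val1 amulx1 (coinv_E_v vP). Qed.

Lemma coinv_actM g h a : coinv_act (g ** h) a = coinv_act g (coinv_act h a).
Proof.
apply/val_inj; rewrite !val_coinv_act sw_comulM; last by mlin.
apply: eq_tlift => g1 g2; rewrite mul_swr mul_swl; apply: eq_tlift => h1 h2.
by rewrite antipodeM !(morph_mul vP) !amulA.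
Qed.

(** The right side is v(h_1) a v(S(h_2) h_3) b v(S h_4). The middle factor is v(eps_s(h_2)), which
    commutes with a and is absorbed by h_1. *)
Lemma coinv_act_mul h a b :
  coinv_act h (a ** b) = \sw_(h1, h2 <- comul h) (coinv_act h1 a ** coinv_act h2 b).
Proof.
apply/val_inj; rewrite val_coinv_act valM (comp_tlift _ _ vlin).
transitivity (\sw_(h1, h2 <- comul h) \sw_(x, y <- comul h1)
    (v (x ** eps_s y) ** val a ** val b ** v (antipode h2))).
  apply: eq_tlift => h1 h2.
  rewrite -{1}(comul_eps_s h1) lin_sw !mul_swl; apply: eq_tlift => x y.
  by rewrite !amulA.
transitivity (\sw_(h1, h2 <- comul h) \sw_(x, r <- comul h2) \sw_(y, z <- comul r)
    (v h1 ** val a ** v (antipode x ** y) ** val b ** v (antipode z))); last first.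
  transitivity (\sw_(h1, h2 <- comul h) \sw_(u, x <- comul h1) \sw_(y, z <- comul h2)
      (v u ** val a ** v (antipode x ** y) ** val b ** v (antipode z))).
    rewrite (@sw_coA _ _ _ (fun u x w => \sw_(y, z <- comul w)
      (v u ** val a ** v (antipode x ** y) ** val b ** v (antipode z)))) //; mlin.
  apply: eq_tlift => h1 h2; rewrite valM !val_coinv_act mul_swl.
  apply: eq_tlift => u x; rewrite mul_swr; apply: eq_tlift => y z.
  by rewrite (morph_mul vP) !amulA.
rewrite (@sw_coA _ _ _ (fun x y z => v (x ** eps_s y) ** val a ** val b ** v (antipode z)));
  last by mlin.
apply: eq_tlift => h1 h2.
rewrite -(@sw_coA _ _ _ (fun x y z =>
  v h1 ** val a ** v (antipode x ** y) ** val b ** v (antipode z))); last by mlin.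
apply: eq_tlift => s z.
rewrite (@sw_antipodel _ _ _ (fun t => v h1 ** val a ** v t ** val b ** v (antipode z)));
  last by mlin.
by rewrite (morph_mul vP) -(amulA (v h1)) -(coinv_comm Bco vP (valP a)) !amulA.
Qed.

Lemma coinv_module_algebra : module_algebra coinv_act.
Proof.
split=> [|a|g h a|h a b|h].
- by rewrite /coinv_act; mlin.
- by rewrite /coinv_act (morph_one vP) amul1x coinv_proj_val.
- exact: coinv_actM.
- exact: coinv_act_mul.
- by apply/val_inj; rewrite !val_coinv_act1 eps_t_idem.
Qed.

(** * The smash product and its isomorphism with B *)

Local Notation S := (smash coinv_module_algebra).
Local Notation "a # h" := (smash_tens coinv_module_algebra a h) (at level 40).

Let tB : bilinear_for *:%R *:%R (smash_tens coinv_module_algebra).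
Proof. exact: smash_tens_bilinear. Qed.

(** The formula respects the balancing relations because z acts on 1 as v(eps_t(z)) = v(z) for z in
    H_t. *)
Lemma smash_to_ex : exists phi : {linear S -> B},
  forall a h, phi (a # h) = val a ** v h.
Proof.
have L : linear (fun t : A \ox H => \sw_(a, h <- t) (val a ** v h)) by mlin.
have [|phi phiE] := @lquot_lift _ _ _ (balanced coinv_act) _ L.
  move=> _ [a z h [g ->]]; rewrite (linB _ _ L) !tlift_tens; [|mlin..].
  by rewrite valM val_coinv_act1 eps_t_idem (morph_mul vP) amulA subrr.
by exists phi => a h; rewrite [LHS]phiE tlift_tens; last by mlin.
Qed.

Section SmashIso.
Variable phi : {linear S -> B}.
Hypothesis phiE : forall a h, phi (a # h) = val a ** v h.

Lemma smash_phi1 : phi \1 = \1.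
Proof. by rewrite [LHS]phiE (morph_one vP) amulx1. Qed.

(** The claim reduces to (h_1 > b) v(h_2) = v(h) b: the left side is v(h_1) b v(eps_s(h_2)), and
    v(eps_s(h_2)) moves past b to be absorbed by h_1. *)
Lemma smash_phiM x y : phi (x ** y) = phi x ** phi y.
Proof.
have phiL : linear phi by exact: linearP.
move: x; apply: smash_ext => [||a h]; [mlin..|].
move: y; apply: smash_ext => [||b g]; [mlin..|].
rewrite [_ ** _ in LHS](smash_mul_tens coinv_module_algebra a h b g) lin_sw !phiE.
transitivity (\sw_(h1, h2 <- comul h) (val a ** (v (h1 ** eps_s h2) ** val b) ** v g)).
  transitivity (\sw_(h1, h2 <- comul h) \sw_(u, x <- comul h1)
      (val a ** (v u ** val b ** v (antipode x ** h2)) ** v g)).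
    apply: eq_tlift => h1 h2; rewrite phiE valM val_coinv_act mul_swr mul_swl.
    by apply: eq_tlift => u x; rewrite !(morph_mul vP) !amulA.
  rewrite (@sw_coA _ _ _ (fun u x y =>
    val a ** (v u ** val b ** v (antipode x ** y)) ** v g)); last by mlin.
  apply: eq_tlift => u r.
  rewrite (@sw_antipodel _ _ _ (fun z => val a ** (v u ** val b ** v z) ** v g)); last by mlin.
  by rewrite (morph_mul vP) -(amulA (v u)) -(coinv_comm Bco vP (valP b)) !amulA.
rewrite -[h in RHS]comul_eps_s lin_sw mul_swr mul_swl.
by apply: eq_tlift => h1 h2; rewrite !amulA.
Qed.

Definition smash_inv (b : B) : S := \sw_(b0, b1 <- rho b) (coinv_proj b0 # b1).
Lemma smash_inv_linear : linear smash_inv.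
Proof. by rewrite /smash_inv; mlin. Qed.
HB.instance Definition _ := GRing.isLinear.Build k B S _ smash_inv smash_inv_linear.

Lemma smash_phiK : cancel smash_inv phi.
Proof.
move=> b; rewrite -[RHS](coinv_E_recons Bco vP) [LHS]lin_sw.
by apply: eq_tlift => b0 b1; rewrite phiE.
Qed.

(** From rho(a v(h)) = a v(h_1) (x) h_2 and E(a v(h_1)) = a v(eps_t(h_1)), balancing moves
    eps_t(h_1) onto h_2, and eps_t(h_1) h_2 = h. *)
Lemma smash_inv_phi a h : smash_inv (val a ** v h) = a # h.
Proof.
rewrite /smash_inv (sw_coinvMl Bco vP (valP a)); last by mlin.
rewrite (sw_rcoact_v vP); last by mlin.
rewrite -[h in RHS]eps_t_comul (comp_tlift (L := smash_tens _ a)); last by mlin.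
apply: eq_tlift => h1 h2; rewrite -smash_balanced; last exact: target_eps.
congr (_ # _); apply/val_inj.
by rewrite coinv_projM !valM val_coinv_act1 eps_t_idem val_coinv_proj (coinv_E_v vP).
Qed.

Lemma smash_invK : cancel phi smash_inv.
Proof.
have iL := smash_inv_linear.
apply: smash_ext => [||a h]; [mlin | mlin |].
by rewrite phiE smash_inv_phi.
Qed.

Lemma smash_rcoactE (rhoS : {linear S -> (S \ox H)%type}) :
  (forall x, rhoS x = tmap smash_inv idfun (rho (phi x))) ->
  forall a h, rhoS (a # h) = \sw_(h1, h2 <- comul h) ((a # h1) \ox h2).
Proof.
have iL := smash_inv_linear; move=> rhoSE a h.
rewrite rhoSE phiE /tmap (sw_coinvMl Bco vP (valP a)); last by mlin.
rewrite (sw_rcoact_v vP); last by mlin.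
by apply: eq_tlift => h1 h2; rewrite smash_inv_phi.
Qed.

Lemma smash_lcoactE (lamS : {linear S -> (H \ox S)%type}) :
  (forall x, lamS x = tmap idfun smash_inv (lam (phi x))) ->
  forall a h, lamS (a # h) =
    \sw_(x, a0 <- coinv_lcoact a) \sw_(h1, h2 <- comul h) ((x ** h1) \ox (a0 # h2)).
Proof.
have iL := smash_inv_linear; move=> lamSE a h.
rewrite lamSE phiE /tmap (sw_lcoactM Bco); last by mlin.
rewrite -sw_coinv_lcoact_val; last by mlin.
apply: eq_tlift => x a0; rewrite (sw_lcoact_v vP); last by mlin.
by apply: eq_tlift => h1 h2; rewrite smash_inv_phi.
Qed.
End SmashIso.
End Structure.

Theorem theorem2p7 (k : fieldType) (H : weakHopfAlgType k)
    (antipode_bij : bijective (@antipode k H))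
    (B : unitalAlgType k)
    (rhoB : {linear B -> (B \ox H)%type}) (lamB : {linear B -> (H \ox B)%type})
    (B_bicom : bicomodule_algebra rhoB lamB)
    (v : {linear H -> B})
    (v_mor : bicomodule_algebra_morphism
               (@comul k H) (@comul k H) rhoB lamB v) :
  let A := coinv (bicomod_right B_bicom) in
  exists lamA : {linear A -> (H \ox A)%type},
    [/\ (forall a : A, tmap idfun val (lamA a) = lamB (val a)),
        left_comodule_algebra lamA
      & exists (act : H -> A -> A) (actP : module_algebra act),
        (forall (h : H) (a : A),
            val (act h a) = coinv_E rhoB v (v h ** val a)) /\
        exists (rho : {linear smash actP -> (smash actP \ox H)%type})
               (lam : {linear smash actP -> (H \ox smash actP)%type})
               (phi : {linear smash actP -> B}),
          [/\ (forall (a : A) (h : H),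
                 rho (smash_tens actP a h) =
                 \sw_(h1, h2 <- comul h) (smash_tens actP a h1 \ox h2)),
              (forall (a : A) (h : H),
                 lam (smash_tens actP a h) =
                 \sw_(x, a0 <- lamA a) \sw_(h1, h2 <- comul h)
                   ((x ** h1) \ox smash_tens actP a0 h2)),
              bicomodule_algebra rho lam,
              (forall (a : A) (h : H),
                 phi (smash_tens actP a h) = val a ** v h)
            & bicomodule_algebra_isomorphism rho lam rhoB lamB phi]].
Proof.
move=> A; exists (@coinv_lcoact _ _ _ _ _ B_bicom _ v_mor).
split; [exact: coinv_lcoact_val | exact: coinv_left_comodule_algebra |].
exists (@coinv_act _ _ _ _ _ B_bicom _ v_mor), (coinv_module_algebra B_bicom v_mor).
split; first by [].
have [phi phiE] := @smash_to_ex _ _ _ _ _ B_bicom _ v_mor.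
pose psi : {linear B -> _} := @smash_inv _ _ _ _ _ B_bicom _ v_mor.
(* Both coactions are defined through B; the displayed formulas on a # h are then derived. *)
have rhoL : linear (fun x => tmap psi idfun (rhoB (phi x))) by rewrite /tmap; mlin.
have lamL : linear (fun x => tmap idfun psi (lamB (phi x))) by rewrite /tmap; mlin.
have [[rho rhoE] [lam lamE]] := (linear_bundle rhoL, linear_bundle lamL).
exists rho, lam, phi; split.
- exact: smash_rcoactE phiE _ rhoE.
- exact: smash_lcoactE phiE _ lamE.
- exact: (transport_bicomodule B_bicom (smash_invK phiE) (smash_phiK phiE)
    (smash_phi1 phiE) (smash_phiM phiE) rhoE lamE).
- exact: phiE.
- exact: (transport_isomorphism (smash_invK phiE) (smash_phiK phiE)
    (smash_phi1 phiE) (smash_phiM phiE) rhoE lamE).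
Qed.
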